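(* Let $(\mathcal B,\mathbb E,\mathfrak s)$ be an extriangulated category. For any cotorsion pair $(\mathcal U,\mathcal V)$ on $\mathcal B$, the associated functor $H\colon\mathcal B\to\underline{\mathcal H}$ to its heart is cohomological.
   Context: Extriangulated category $(\mathcal B,\mathbb E,\mathfrak s)$: (ET1) $\mathcal B$ is an additive category and $\mathbb E\colon\mathcal B^{\mathrm{op}}\times\mathcal B\to \mathrm{Ab}$ is an additive bifunctor; for $\delta\in\mathbb E(C,A)$, $a\colon A\to A'$, $c\colon C'\to C$ write $a_*\delta=\mathbb E(C,a)(\delta)$ and $c^*\delta=\mathbb E(c,A)(\delta)$. Sequences $A\to B\to C$ and $A\to B'\to C$ are equivalent if there is an isomorphism $B\cong B'$ compatible with the identities of $A$ and $C$. $\mathfrak s$ assigns to each $\delta\in\mathbb E(C,A)$ an equivalence class $\mathfrak s(\delta)=[A\xrightarrow{x}B\xrightarrow{y}C]$; we say $A\xrightarrow{x}B\xrightarrow{y}C$ realizes $\delta$. (ET2) $\mathfrak s$ is an additive realization: if $A\xrightarrow{x}B\xrightarrow{y}C$ realizes $\delta$, $A'\xrightarrow{x'}B'\xrightarrow{y'}C'$ realizes $\delta'$ and $a\colon A\to A'$, $c\colon C\to C'$ satisfy $a_*\delta=c^*\delta'$, then there is $b\colon B\to B'$ with $bx=x'a$, $y'b=cy$; $0\in\mathbb E(C,A)$ is realized by the split sequence $A\to A\oplus C\to C$; and $\mathfrak s(\delta\oplus\delta')=\mathfrak s(\delta)\oplus\mathfrak s(\delta')$. (ET3) If $A\xrightarrow{x}B\xrightarrow{y}C$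 realizes $\delta\in\mathbb E(C,A)$, $A'\xrightarrow{x'}B'\xrightarrow{y'}C'$ realizes $\delta'\in\mathbb E(C',A')$ and $a\colon A\to A'$, $b\colon B\to B'$ satisfy $bx=x'a$, then there is $c\colon C\to C'$ with $cy=y'b$ and $a_*\delta=c^*\delta'$; and (ET3)$^{\mathrm{op}}$, its dual. (ET4) If $\delta\in\mathbb E(D,A)$ and $\delta'\in\mathbb E(F,B)$ are realized by $A\xrightarrow{f}B\xrightarrow{f'}D$ and $B\xrightarrow{g}C\xrightarrow{g'}F$, there are an object $E$, morphisms $d\colon D\to E$, $e\colon E\to F$, $h'\colon C\to E$ with $h'g=df'$, $eh'=g'$, and $\delta''\in\mathbb E(E,A)$ realized by $A\xrightarrow{gf}C\xrightarrow{h'}E$, such that $D\xrightarrow{d}E\xrightarrow{e}F$ realizes $f'_*\delta'$, $d^*\delta''=\delta$ and $f_*\delta''=e^*\delta'$; and (ET4)$^{\mathrm{op}}$, its dual. A conflation $A\rightarrowtail B\twoheadrightarrow C$ is a sequence realizing some $\delta\in\mathbb E(C,A)$. For full subcategories $\mathcal X,\mathcal Y\subseteq\mathcal B$: $\mathrm{Cone}(\mathcal X,\mathcal Y)$ is the full subcategory of objects $B$ admitting a conflation $X\rightarrowtail Y\twoheadrightarrow B$, and $\mathrm{CoCone}(\mathcal X,\mathcal Y)$ that of objects $B$ admitting a conflation $B\rightarrowtail X\twoheadrightarrow Y$, with $X\in\mathcal X$, $Y\in\mathcal Y$. A cotorsion pair $(\mathcal U,\mathcal V)$ on $\mathcal B$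 is a pair of full additive subcategories closed under direct summands and isomorphisms with $\mathbb E(\mathcal U,\mathcal V)=0$ and such that every $B\in\mathcal B$ admits conflations $V_B\rightarrowtail U_B\twoheadrightarrow B$ and $B\rightarrowtail V^B\twoheadrightarrow U^B$ with $U_B,U^B\in\mathcal U$, $V_B,V^B\in\mathcal V$. Put $\mathcal W=\mathcal U\cap\mathcal V$, $\mathcal B^+=\mathrm{Cone}(\mathcal V,\mathcal W)$, $\mathcal B^-=\mathrm{CoCone}(\mathcal W,\mathcal U)$, $\mathcal H=\mathcal B^+\cap\mathcal B^-$, $\underline{\mathcal B}=\mathcal B/\mathcal W$ (ideal quotient by morphisms factoring through $\mathcal W$; $\underline f$ is the image of $f$), $\underline{\mathcal B}^{\pm}=\mathcal B^{\pm}/\mathcal W$. The heart is $\underline{\mathcal H}=\mathcal H/\mathcal W$, which is an abelian category. A reflection sequence for $B$ is a conflation $B\overset{z}{\rightarrowtail}Z\twoheadrightarrow U$ with $Z\in\mathcal B^+$, $U\in\mathcal U$ such that $z^*\colon\mathbb E(Z,V)\to\mathbb E(B,V)$ is surjective for all $V\in\mathcal V$. A coreflection sequence for $B$ is a conflation $V\rightarrowtail X\overset{x}{\twoheadrightarrow}B$ with $X\in\mathcal B^-$, $V\in\mathcal V$ such that $x_*\colon\mathbb E(U,X)\to\mathbb E(U,B)$ is surjective for all $U\in\mathcal U$. Every object has both. For each $B$ choose a reflection sequence $B\overset{p_B}{\rightarrowtail}B^+\twoheadrightarrow U$ and a coreflection sequence $V\rightarrowtail B^-\overset{m_B}{\twoheadrightarrow}B$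 (with $B^{\pm}=B$ and identity map if $B\in\mathcal B^{\pm}$). The functor $\sigma^+\colon\underline{\mathcal B}\to\underline{\mathcal B}^+$ is $B\mapsto B^+$, with $\sigma^+(\underline f)$ for $f\colon B\to C$ the unique morphism satisfying $\sigma^+(\underline f)\,\underline{p_B}=\underline{p_C}\,\underline f$; dually $\sigma^-\colon\underline{\mathcal B}\to\underline{\mathcal B}^-$ is $B\mapsto B^-$, with $\underline{m_C}\,\sigma^-(\underline f)=\underline f\,\underline{m_B}$. With $\pi\colon\mathcal B\to\underline{\mathcal B}$ the quotient functor, $H=\sigma^-\circ\sigma^+\circ\pi\colon\mathcal B\to\underline{\mathcal H}$. An additive functor $F\colon\mathcal B\to\mathcal A$ to an abelian category is cohomological if every conflation $A\overset{x}{\rightarrowtail}B\overset{y}{\twoheadrightarrow}C$ yields an exact sequence $F(A)\xrightarrow{F(x)}F(B)\xrightarrow{F(y)}F(C)$. *)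

(* Defs.v *)
From HB Require Import structures.
From mathcomp Require Import all_boot all_order all_algebra.
From mathcomp Require Import generic_quotient ring_quotient.
From mathcomp Require Import boolp.

Set Implicit Arguments.
Unset Strict Implicit.
Unset Printing Implicit Defensive.

Import GRing.Theory.
Local Open Scope ring_scope.
Local Open Scope quotient_scope.

Declare Scope cat_scope.
Delimit Scope cat_scope with C.
Local Open Scope cat_scope.

#[local] Obligation Tactic := idtac.

(* Every abelian group is a [zmodType] in the presence of choice. *)
Record preadditive := Preadditive {
  obj :> Type;
  hom : obj -> obj -> zmodType;
  idm : forall A, hom A A;
  comp : forall A B C, hom B C -> hom A B -> hom A C;
  compA : forall A B C D (h : hom C D) (g : hom B C) (f : hom A B),
    comp h (comp g f) = comp (comp h g) f;
  comp1m : forall A B (f : hom A B), comp (idm B) f = f;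
  compm1 : forall A B (f : hom A B), comp f (idm A) = f;
  compDl : forall A B C (g g' : hom B C) (f : hom A B),
    comp (g + g') f = comp g f + comp g' f;
  compDr : forall A B C (g : hom B C) (f f' : hom A B),
    comp g (f + f') = comp g f + comp g f' }.

Arguments hom {p} A B.
Arguments idm {p} A.
Arguments comp {p A B C} g f.
Notation "g \oc f" := (comp g f) (at level 40, left associativity) : cat_scope.

Section Preadditive.
Variable C : preadditive.
Implicit Types A B S Z K Q : C.

Definition is_zero Z : Prop := idm Z = 0.

Definition is_biproduct A B S (i1 : hom A S) (i2 : hom B S)
    (p1 : hom S A) (p2 : hom S B) : Prop :=
  [/\ p1 \oc i1 = idm A, p2 \oc i2 = idm B, p1 \oc i2 = 0, p2 \oc i1 = 0
    & i1 \oc p1 + i2 \oc p2 = idm S].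

Definition is_additive : Prop :=
  (exists Z, is_zero Z) /\
  forall A B, exists S (i1 : hom A S) (i2 : hom B S)
    (p1 : hom S A) (p2 : hom S B), is_biproduct i1 i2 p1 p2.

Definition isomorphic A B : Prop :=
  exists (f : hom A B) (g : hom B A), g \oc f = idm A /\ f \oc g = idm B.

Definition is_mono A B (f : hom A B) : Prop :=
  forall T (g h : hom T A), f \oc g = f \oc h -> g = h.

Definition is_epi A B (f : hom A B) : Prop :=
  forall T (g h : hom B T), g \oc f = h \oc f -> g = h.

Definition is_kernel A B K (f : hom A B) (k : hom K A) : Prop :=
  f \oc k = 0 /\
  forall T (t : hom T A), f \oc t = 0 -> exists! s : hom T K, k \oc s = t.

Definition is_cokernel A B Q (f : hom A B) (c : hom B Q) : Prop :=
  c \oc f = 0 /\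
  forall T (t : hom B T), t \oc f = 0 -> exists! s : hom Q T, s \oc c = t.

Definition is_abelian : Prop :=
  [/\ is_additive,
      forall A B (f : hom A B), exists K (k : hom K A), is_kernel f k,
      forall A B (f : hom A B), exists Q (c : hom B Q), is_cokernel f c,
      forall A B (m : hom A B), is_mono m ->
        exists D (g : hom B D), is_kernel g m
    & forall A B (e : hom A B), is_epi e ->
        exists D (g : hom D A), is_cokernel g e].

(* [Im f = Ker g] as subobjects of [A2], where [Im f = Ker (Coker f)]. *)
Definition exact A1 A2 A3 (f : hom A1 A2) (g : hom A2 A3) : Prop :=
  exists Q (c : hom A2 Q) K (k : hom K A2),
    [/\ is_cokernel f c, is_kernel c k & is_kernel g k].

Definition additive_subcategory (P : C -> Prop) : Prop :=
  (forall Z, is_zero Z -> P Z) /\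
  forall A B S (i1 : hom A S) (i2 : hom B S) (p1 : hom S A) (p2 : hom S B),
    is_biproduct i1 i2 p1 p2 -> P A -> P B -> P S.

Definition summand_closed (P : C -> Prop) : Prop :=
  forall A B S (i1 : hom A S) (i2 : hom B S) (p1 : hom S A) (p2 : hom S B),
    is_biproduct i1 i2 p1 p2 -> P S -> P A.

Definition iso_closed (P : C -> Prop) : Prop :=
  forall A B, isomorphic A B -> P A -> P B.

Definition factors (P : C -> Prop) A B (f : hom A B) : Prop :=
  exists S (g : hom S B) (h : hom A S), P S /\ f = g \oc h.

Lemma comp0m A B D (f : hom A B) : (0 : hom B D) \oc f = 0.
Proof. by apply: (addrI (0 \oc f)); rewrite -compDl !addr0. Qed.

Lemma compm0 A B D (g : hom B D) : g \oc (0 : hom A B) = 0.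
Proof. by apply: (addrI (g \oc 0)); rewrite -compDr !addr0. Qed.

Lemma compNl A B D (g : hom B D) (f : hom A B) : (- g) \oc f = - (g \oc f).
Proof. by apply: (addrI (g \oc f)); rewrite -compDl !subrr comp0m. Qed.

Lemma compNr A B D (g : hom B D) (f : hom A B) : g \oc (- f) = - (g \oc f).
Proof. by apply: (addrI (g \oc f)); rewrite -compDr !subrr compm0. Qed.

Lemma compBl A B D (g g' : hom B D) (f : hom A B) :
  (g - g') \oc f = g \oc f - g' \oc f.
Proof. by rewrite compDl compNl. Qed.

Lemma compBr A B D (g : hom B D) (f f' : hom A B) :
  g \oc (f - f') = g \oc f - g \oc f'.
Proof. by rewrite compDr compNr. Qed.

Lemma biproductC A B S (i1 : hom A S) (i2 : hom B S) p1 p2 :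
  is_biproduct i1 i2 p1 p2 -> is_biproduct i2 i1 p2 p1.
Proof. by case=> *; split=> //; rewrite addrC. Qed.

Lemma biproduct0l Z T : is_zero Z ->
  is_biproduct (0 : hom Z T) (idm T) (0 : hom T Z) (idm T).
Proof. by move=> Z0; split; rewrite ?comp1m ?compm1 ?comp0m ?add0r ?Z0. Qed.

Lemma factorsD (P : C -> Prop) A B (f g : hom A B) :
  is_additive -> additive_subcategory P ->
  factors P f -> factors P g -> factors P (f + g).
Proof.
move=> [_ hS] [_ hP] [S [a [b [PS ->]]]] [T [c [d [PT ->]]]].
have [X [i1 [i2 [p1 [p2 h]]]]] := hS S T.
exists X, (a \oc p1 + c \oc p2), (i1 \oc b + i2 \oc d); split.
  exact: hP h PS PT.
case: h => h1 h2 h3 h4 _; rewrite compDl !compDr -!compA.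
rewrite (compA p1) (compA p2) (compA p1 i2) (compA p2 i2) h1 h2 h3 h4.
by rewrite !comp0m !compm0 !comp1m addr0 add0r.
Qed.

Lemma factorsN (P : C -> Prop) A B (f : hom A B) :
  factors P f -> factors P (- f).
Proof. by case=> S [a [b [PS ->]]]; exists S, (- a), b; rewrite compNl. Qed.

Lemma factors0 (P : C -> Prop) A B :
  is_additive -> additive_subcategory P -> factors P (0 : hom A B).
Proof.
move=> [[Z Z0] _] [P0 _]; exists Z, 0, 0; rewrite comp0m; split=> //.
exact: P0.
Qed.

Lemma factors_compl (P : C -> Prop) A B D (g : hom B D) (f : hom A B) :
  factors P f -> factors P (g \oc f).
Proof.
by case=> S [a [b [PS ->]]]; exists S, (g \oc a), b; rewrite compA.
Qed.

Lemma factors_compr (P : C -> Prop) A B D (g : hom B D) (f : hom A B) :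
  factors P g -> factors P (g \oc f).
Proof.
by case=> S [a [b [PS ->]]]; exists S, a, (b \oc f); rewrite compA.
Qed.

End Preadditive.

Definition op (C : preadditive) : preadditive := @Preadditive C
  (fun A B => @hom C B A) (@idm C) (fun A B D g f => f \oc g)
  (fun A B D E h g f => esym (compA f g h))
  (fun A B f => compm1 f) (fun A B f => comp1m f)
  (fun A B D g g' f => compDr f g g') (fun A B D g f f' => compDl f f' g).

Definition full (C : preadditive) (P : C -> Prop) : preadditive := @Preadditive
  {A : C | P A} (fun A B => hom (sval A) (sval B)) (fun A => idm (sval A))
  (fun A B D g f => g \oc f) (fun A B D E h g f => compA h g f)
  (fun A B f => comp1m f) (fun A B f => compm1 f)
  (fun A B D g g' f => compDl g g' f) (fun A B D g f f' => compDr g f f').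

Record functor (C D : preadditive) := Functor {
  fobj :> C -> D;
  fmap : forall A B : C, hom A B -> hom (fobj A) (fobj B);
  fmap1 : forall A, fmap (idm A) = idm (fobj A);
  fmapM : forall A B E (g : hom B E) (f : hom A B),
    fmap (g \oc f) = fmap g \oc fmap f }.

Arguments fmap {C D} F {A B} f : rename.

Definition additive_functor (C D : preadditive) (F : functor C D) : Prop :=
  forall (A B : C) (f g : hom A B), fmap F (f + g) = fmap F f + fmap F g.

Section FunctorConstructions.
Variables C D E : preadditive.

Program Definition fcomp (G : functor D E) (F : functor C D) : functor C E :=
  @Functor C E (fun A => G (F A)) (fun A B f => fmap G (fmap F f)) _ _.
Next Obligation. by move=> * /=; rewrite !fmap1. Qed.
Next Obligation. by move=> * /=; rewrite !fmapM. Qed.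

Definition full_incl (P : C -> Prop) : functor (full P) C :=
  @Functor (full P) C (fun A => sval A) (fun A B f => f)
    (fun=> erefl) (fun _ _ _ _ _ => erefl).

Program Definition full_lift (P : D -> Prop) (F : functor C D)
    (FP : forall A, P (F A)) : functor C (full P) :=
  @Functor C (full P) (fun A => exist P (F A) (FP A)) (fun A B f => fmap F f)
    _ _.
Next Obligation. by move=> * /=; rewrite !fmap1. Qed.
Next Obligation. by move=> * /=; rewrite !fmapM. Qed.

End FunctorConstructions.

Section IdealQuotient.
Variables (C : preadditive) (P : C -> Prop).
Hypotheses (C_add : is_additive C) (P_add : additive_subcategory P).

(* [P] being closed under finite sums, the morphisms factoring through [P] form
   an ideal. *)
Definition in_ideal (A B : C) (f : hom A B) : bool := `[< factors P f >].

Lemma in_ideal_zmod_closed (A B : C) : zmod_closed (@in_ideal A B).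
Proof.
split=> [|f g /asboolP hf /asboolP hg]; apply/asboolP; first exact: factors0.
by apply: factorsD => //; apply: factorsN.
Qed.

Definition ideal (A B : C) : zmodClosed (hom A B) :=
  HB.pack (@in_ideal A B)
    (GRing.isZmodClosed.Build _ _ (@in_ideal_zmod_closed A B)).

Definition qhom (A B : C) : zmodType := Quotient.quot (ideal A B).

Definition qpi (A B : C) (f : hom A B) : qhom A B := \pi f.

Lemma qpi_eq (A B : C) (f g : hom A B) : qpi f = qpi g <-> factors P (f - g).
Proof.
rewrite /qpi; split=> [/eqP|h]; last apply/eqP.
  by rewrite -Quotient.idealrBE => /asboolP.
by rewrite -Quotient.idealrBE; apply/asboolP.
Qed.

Lemma qpiD (A B : C) (f g : hom A B) : qpi (f + g) = qpi f + qpi g.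
Proof. exact: (raddfD (\pi_(Quotient.quot (ideal A B)))). Qed.

Lemma qpi_surj (A B : C) (f : qhom A B) : exists g, f = qpi g.
Proof. by exists (repr f); rewrite /qpi reprK. Qed.

Definition qcomp (A B D : C) (g : qhom B D) (f : qhom A B) : qhom A D :=
  qpi (repr g \oc repr f).

Lemma qpiM (A B D : C) (g : hom B D) (f : hom A B) :
  qpi (g \oc f) = qcomp (qpi g) (qpi f).
Proof.
have h (X Y : C) (k : hom X Y) : factors P (k - repr (qpi k)).
  by apply/qpi_eq; rewrite /qpi reprK.
apply/qpi_eq; set g' := repr _; set f' := repr _.
have -> : g \oc f - g' \oc f' = (g - g') \oc f + g' \oc (f - f').
  by rewrite compBl compBr addrA subrK.
apply: factorsD => //; first by apply: factors_compr; apply: h.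
by apply: factors_compl; apply: h.
Qed.

Program Definition quotient : preadditive :=
  @Preadditive C qhom (fun A => qpi (idm A)) qcomp _ _ _ _ _.
Next Obligation.
move=> A B D E h g f.
have [h' ->] := qpi_surj h; have [g' ->] := qpi_surj g.
by have [f' ->] := qpi_surj f; rewrite -!qpiM compA.
Qed.
Next Obligation.
by move=> A B f; have [f' ->] := qpi_surj f; rewrite -qpiM comp1m.
Qed.
Next Obligation.
by move=> A B f; have [f' ->] := qpi_surj f; rewrite -qpiM compm1.
Qed.
Next Obligation.
move=> A B D g1 g2 f; have [g1' ->] := qpi_surj g1.
have [g2' ->] := qpi_surj g2; have [f' ->] := qpi_surj f.
by rewrite -qpiD -!qpiM -qpiD compDl.
Qed.
Next Obligation.
move=> A B D g f1 f2; have [f1' ->] := qpi_surj f1.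
have [f2' ->] := qpi_surj f2; have [g' ->] := qpi_surj g.
by rewrite -qpiD -!qpiM -qpiD compDr.
Qed.

Definition quotient_functor : functor C quotient :=
  @Functor C quotient (fun A => A) qpi (fun=> erefl) qpiM.

End IdealQuotient.

Definition seq_equiv (C : preadditive) (A D B B' : C)
    (x : hom A B) (y : hom B D) (x' : hom A B') (y' : hom B' D) : Prop :=
  exists (b : hom B B') (b' : hom B' B),
    [/\ b' \oc b = idm B, b \oc b' = idm B', b \oc x = x' & y' \oc b = y].

(* [ext D A] is E(D, A), [push a d] is a_* d and [pull c d] is c^* d.
   [realizes x y d] says that the sequence (x, y) belongs to the class s(d). *)
Record extriangulated := Extriangulated {
  base :> preadditive;
  base_additive : is_additive base;

  ext : base -> base -> zmodType;
  push : forall D A A' : base, hom A A' -> ext D A -> ext D A';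
  pull : forall D D' A : base, hom D' D -> ext D A -> ext D' A;
  pushD : forall D A A' (a : hom A A') (d d' : ext D A),
    push a (d + d') = push a d + push a d';
  pullD : forall D D' A (c : hom D' D) (d d' : ext D A),
    pull c (d + d') = pull c d + pull c d';
  push1 : forall D A (d : ext D A), push (idm A) d = d;
  pull1 : forall D A (d : ext D A), pull (idm D) d = d;
  pushM : forall D A A' A'' (a' : hom A' A'') (a : hom A A') (d : ext D A),
    push (a' \oc a) d = push a' (push a d);
  pullM : forall D D' D'' A (c : hom D' D) (c' : hom D'' D') (d : ext D A),
    pull (c \oc c') d = pull c' (pull c d);
  push_pull : forall D D' A A' (a : hom A A') (c : hom D' D) (d : ext D A),
    push a (pull c d) = pull c (push a d);
  pushDl : forall D A A' (a a' : hom A A') (d : ext D A),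
    push (a + a') d = push a d + push a' d;
  pullDl : forall D D' A (c c' : hom D' D) (d : ext D A),
    pull (c + c') d = pull c d + pull c' d;

  realizes : forall A B D : base, hom A B -> hom B D -> ext D A -> Prop;
  realizes_ex : forall D A (d : ext D A),
    exists B (x : hom A B) (y : hom B D), realizes x y d;
  realizes_class : forall A B B' D (x : hom A B) (y : hom B D)
      (x' : hom A B') (y' : hom B' D) (d : ext D A),
    realizes x y d -> (realizes x' y' d <-> seq_equiv x y x' y');

  realizes_morph : forall A B D A' B' D'
      (x : hom A B) (y : hom B D) (d : ext D A)
      (x' : hom A' B') (y' : hom B' D') (d' : ext D' A')
      (a : hom A A') (c : hom D D'),
    realizes x y d -> realizes x' y' d' -> push a d = pull c d' ->
    exists b : hom B B', b \oc x = x' \oc a /\ y' \oc b = c \oc y;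
  realizes_split : forall A D S (i1 : hom A S) (i2 : hom D S)
      (p1 : hom S A) (p2 : hom S D),
    is_biproduct i1 i2 p1 p2 -> realizes i1 p2 0;
  realizes_sum : forall A A' AA B B' BB D D' DD
      (iA : hom A AA) (iA' : hom A' AA) (pA : hom AA A) (pA' : hom AA A')
      (iB : hom B BB) (iB' : hom B' BB) (pB : hom BB B) (pB' : hom BB B')
      (iD : hom D DD) (iD' : hom D' DD) (pD : hom DD D) (pD' : hom DD D')
      (x : hom A B) (y : hom B D) (d : ext D A)
      (x' : hom A' B') (y' : hom B' D') (d' : ext D' A'),
    is_biproduct iA iA' pA pA' -> is_biproduct iB iB' pB pB' ->
    is_biproduct iD iD' pD pD' ->
    realizes x y d -> realizes x' y' d' ->
    realizes (iB \oc x \oc pA + iB' \oc x' \oc pA')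
             (iD \oc y \oc pB + iD' \oc y' \oc pB')
             (push iA (pull pD d) + push iA' (pull pD' d'));

  ET3 : forall A B D A' B' D'
      (x : hom A B) (y : hom B D) (d : ext D A)
      (x' : hom A' B') (y' : hom B' D') (d' : ext D' A')
      (a : hom A A') (b : hom B B'),
    realizes x y d -> realizes x' y' d' -> b \oc x = x' \oc a ->
    exists c : hom D D', c \oc y = y' \oc b /\ push a d = pull c d';
  ET3op : forall A B D A' B' D'
      (x : hom A B) (y : hom B D) (d : ext D A)
      (x' : hom A' B') (y' : hom B' D') (d' : ext D' A')
      (b : hom B B') (c : hom D D'),
    realizes x y d -> realizes x' y' d' -> y' \oc b = c \oc y ->
    exists a : hom A A', x' \oc a = b \oc x /\ push a d = pull c d';

  ET4 : forall A B D G F (f : hom A B) (f' : hom B D) (d1 : ext D A)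
      (g : hom B G) (g' : hom G F) (d2 : ext F B),
    realizes f f' d1 -> realizes g g' d2 ->
    exists (E : base) (d : hom D E) (e : hom E F) (h' : hom G E) (d3 : ext E A),
      [/\ h' \oc g = d \oc f', e \oc h' = g',
          realizes (g \oc f) h' d3, realizes d e (push f' d2)
        & pull d d3 = d1 /\ push f d3 = pull e d2];
  ET4op : forall A B D G F (f : hom B A) (f' : hom D B) (d1 : ext A D)
      (g : hom G B) (g' : hom F G) (d2 : ext B F),
    realizes f' f d1 -> realizes g' g d2 ->
    exists (E : base) (d : hom E D) (e : hom F E) (h' : hom E G) (d3 : ext A E),
      [/\ g \oc h' = f' \oc d, h' \oc e = g',
          realizes h' (f \oc g) d3, realizes e d (pull f' d2)
        & push d d3 = d1 /\ pull f d3 = push e d2] }.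

Arguments ext {e} D A.
Arguments push {e D A A'} a d.
Arguments pull {e D D' A} c d.
Arguments realizes {e A B D} x y d.

Section Extriangulated.
Variable C : extriangulated.
Implicit Types A B D X Y T : C.

Definition conflation A B D (x : hom A B) (y : hom B D) : Prop :=
  exists d : ext D A, realizes x y d.

Definition Cone (P Q : C -> Prop) B : Prop :=
  exists X Y (x : hom X Y) (y : hom Y B), [/\ P X, Q Y & conflation x y].

Definition CoCone (P Q : C -> Prop) B : Prop :=
  exists X Y (x : hom B X) (y : hom X Y), [/\ P X, Q Y & conflation x y].

Definition cohomological (D : preadditive) (F : functor C D) : Prop :=
  [/\ is_abelian D, additive_functor F
    & forall X Y Z (x : hom X Y) (y : hom Y Z),
        conflation x y -> exact (fmap F x) (fmap F y)].

Lemma push0 D A A' (a : hom A A') : push a (0 : ext D A) = 0.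
Proof. by apply: (addrI (push a 0)); rewrite -pushD !addr0. Qed.

Lemma pull0 D D' A (c : hom D' D) : pull c (0 : ext D A) = 0.
Proof. by apply: (addrI (pull c 0)); rewrite -pullD !addr0. Qed.

Lemma pullBl D D' A (c c' : hom D' D) (d : ext D A) :
  pull (c - c') d = pull c d - pull c' d.
Proof.
apply: (addIr (pull c' d)); rewrite -pullDl !subrK //.
Qed.

End Extriangulated.

Program Definition op_ext (C : extriangulated) : extriangulated :=
  @Extriangulated (op C) _ (fun D A => @ext C A D)
    (fun D A A' a d => pull (a : @hom C A' A) d)
    (fun D D' A c d => push (c : @hom C D D') d)
    _ _ _ _ _ _ _ _ _
    (fun A B D x y d => realizes (y : @hom C D B) (x : @hom C B A) d)
    _ _ _ _ _ _ _ _ _.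
Next Obligation.
move=> C; have [h0 hS] := base_additive C; split=> // A B.
have [S [i1 [i2 [p1 [p2 h]]]]] := hS A B; exists S, p1, p2, i1, i2.
by case: h.
Qed.
Next Obligation. by move=> *; exact: pullD. Qed.
Next Obligation. by move=> *; exact: pushD. Qed.
Next Obligation. by move=> *; exact: pull1. Qed.
Next Obligation. by move=> *; exact: push1. Qed.
Next Obligation. by move=> *; exact: pullM. Qed.
Next Obligation. by move=> *; exact: pushM. Qed.
Next Obligation. by move=> *; apply/esym/push_pull. Qed.
Next Obligation. by move=> *; exact: pullDl. Qed.
Next Obligation. by move=> *; exact: pushDl. Qed.
Next Obligation.
move=> C D A d; have [B [x [y h]]] := realizes_ex d.
by exists B, y, x.
Qed.
Next Obligation.
move=> C A B B' D x y x' y' d /= h; split.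
  move=> /(realizes_class y' x' h)[b [b' [h1 h2 h3 h4]]].
  exists b', b; split=> //=.
    by rewrite -h4 -compA h2 compm1.
  by rewrite -h3 compA h1 comp1m.
case=> b [b' /= [h1 h2 h3 h4]]; apply/(realizes_class y' x' h).
exists b', b; split=> //.
  by rewrite -h4 compA h2 comp1m.
by rewrite -h3 -compA h1 compm1.
Qed.
Next Obligation.
move=> C A B D A' B' D' x y d x' y' d' a c /= h h' e.
have [b [h1 h2]] := realizes_morph h' h (esym e).
by exists b.
Qed.
Next Obligation.
move=> C A D S i1 i2 p1 p2 /= [h1 h2 h3 h4 h5].
by apply: (realizes_split (i2 := p1) (p1 := i2)); split=> //; rewrite addrC.
Qed.
Next Obligation.
move=> C A A' AA B B' BB D D' DD iA iA' pA pA' iB iB' pB pB' iD iD' pD pD'.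
move=> x y d x' y' d' [? ? ? ? ?] [? ? ? ? ?] [? ? ? ? ?] /= h h'.
rewrite !compA -!push_pull.
by apply: (realizes_sum (iA := pD) (iA' := pD') (pA := iD) (pA' := iD')
  (iB := pB) (iB' := pB') (pB := iB) (pB' := iB')
  (iD := pA) (iD' := pA') (pD := iA) (pD' := iA')).
Qed.
Next Obligation.
move=> C A B D A' B' D' x y d x' y' d' a b /= h h' e.
have [c [h1 h2]] := ET3op h' h e.
by exists c.
Qed.
Next Obligation.
move=> C A B D A' B' D' x y d x' y' d' b c /= h h' e.
have [a [h1 h2]] := ET3 h' h e.
by exists a.
Qed.
Next Obligation.
move=> C A B D G F f f' d1 g g' d2 /= h h'.
have [E [d [e [k [d3 H]]]]] := ET4op h h'.
by exists E, d, e, k, d3.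
Qed.
Next Obligation.
move=> C A B D G F f f' d1 g g' d2 /= h h'.
have [E [d [e [k [d3 H]]]]] := ET4 h h'.
by exists E, d, e, k, d3.
Qed.

Section ExactSequences.
Variable C : extriangulated.
Implicit Types A B D T : C.

Lemma hom_extend A B D (x : hom A B) (y : hom B D) (d : ext D A) T
    (a : hom A T) :
  realizes x y d -> push a d = 0 -> exists b : hom B T, b \oc x = a.
Proof.
move=> h a0; have [S [i1 [i2 [p1 [p2 hS]]]]] := (base_additive C).2 T D.
have [|b [e _]] := realizes_morph (a := a) (c := idm D) h (realizes_split hS).
  by rewrite pull0.
by exists (p1 \oc b); case: hS => e1 _ _ _ _; rewrite -compA e compA e1 comp1m.
Qed.

Lemma hom_coextend A B D (x : hom A B) (y : hom B D) (d : ext D A) T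
    (g : hom B T) :
  realizes x y d -> g \oc x = 0 -> exists c : hom D T, c \oc y = g.
Proof.
move=> h g0; have [[Z Z0] _] := base_additive C.
have hT := realizes_split (biproduct0l T Z0).
have [|c [e _]] := ET3 (a := (0 : hom A Z)) (b := g) h hT.
  by rewrite g0 compm0.
by exists c; rewrite e comp1m.
Qed.

Lemma conflation_comp0 A B D (x : hom A B) (y : hom B D) (d : ext D A) :
  realizes x y d -> y \oc x = 0.
Proof.
move=> h; have [[Z Z0] _] := base_additive C.
have hT := realizes_split (biproductC (biproduct0l A Z0)).
have [|c [e _]] := ET3 (a := idm A) (b := x) hT h; first by [].
by rewrite -e compm0.
Qed.

Lemma push_inflation A B D (x : hom A B) (y : hom B D) (d : ext D A) :
  realizes x y d -> push x d = 0.
Proof.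
move=> h; have [[Z Z0] _] := base_additive C.
have hT := realizes_split (biproductC (biproduct0l B Z0)).
have [|c [_ ->]] := ET3 (a := x) (b := idm B) h hT; first by [].
by rewrite pull0.
Qed.

End ExactSequences.

Section ExactSequencesDual.
Variable C : extriangulated.
Implicit Types A B D T : C.

Lemma hom_lift A B D (x : hom A B) (y : hom B D) (d : ext D A) T
    (c : hom T D) :
  realizes x y d -> pull c d = 0 -> exists b : hom T B, y \oc b = c.
Proof. exact: (@hom_extend (op_ext C) D B A y x d T c). Qed.

Lemma hom_colift A B D (x : hom A B) (y : hom B D) (d : ext D A) T
    (g : hom T B) :
  realizes x y d -> y \oc g = 0 -> exists a : hom T A, x \oc a = g.
Proof. exact: (@hom_coextend (op_ext C) D B A y x d T g). Qed.

Lemma pull_deflation A B D (x : hom A B) (y : hom B D) (d : ext D A) :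
  realizes x y d -> pull y d = 0.
Proof. exact: (@push_inflation (op_ext C) D B A y x d). Qed.

Lemma ext_pull_exact A B D (x : hom A B) (y : hom B D) (d : ext D A) T
    (z : ext B T) :
  realizes x y d -> pull x z = 0 -> exists w : ext D T, z = pull y w.
Proof.
move=> h z0; have [Y [t [s hz]]] := realizes_ex z.
have [E [d' [e [k [w [_ _ _ h' [_ hw]]]]]]] := ET4op h hz.
have [|r hr] := hom_extend (a := idm T) h'; first by rewrite push1.
by exists (push r w); rewrite -push_pull hw -pushM hr push1.
Qed.

End ExactSequencesDual.

Lemma ext_push_exact (C : extriangulated) (A B D : C) (x : hom A B)
    (y : hom B D) (d : ext D A) T (z : ext T B) :
  realizes x y d -> push y z = 0 -> exists w : ext T A, z = push x w.
Proof. exact: (@ext_pull_exact (op_ext C) D B A y x d T z). Qed.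

Record cotorsion_pair (C : extriangulated) := CotorsionPair {
  cotU : C -> Prop;
  cotV : C -> Prop;
  cotU_add : additive_subcategory cotU;
  cotV_add : additive_subcategory cotV;
  cotU_summand : summand_closed cotU;
  cotV_summand : summand_closed cotV;
  cotU_iso : iso_closed cotU;
  cotV_iso : iso_closed cotV;
  cot_ext : forall X Y (d : ext X Y), cotU X -> cotV Y -> d = 0;
  cot_left : forall B, exists (V U : C) (x : hom V U) (y : hom U B),
    [/\ cotV V, cotU U & conflation x y];
  cot_right : forall B, exists (V U : C) (x : hom B V) (y : hom V U),
    [/\ cotV V, cotU U & conflation x y] }.

Arguments cot_ext {C} c {X Y} d.

Section Heart.
Variables (C : extriangulated) (T : cotorsion_pair C).
Local Notation U := (cotU T).
Local Notation V := (cotV T).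

Definition cotW (B : C) : Prop := U B /\ V B.

Definition Bplus (B : C) : Prop := Cone V cotW B.
Definition Bminus (B : C) : Prop := CoCone cotW U B.

Lemma cotW_add : additive_subcategory cotW.
Proof.
have [U0 US] := cotU_add T; have [V0 VS] := cotV_add T.
split=> [Z Z0|A B S i1 i2 p1 p2 h [UA VA] [UB VB]]; split.
- exact: U0.
- exact: V0.
- exact: US h UA UB.
- exact: VS h VA VB.
Qed.

(* [stable] is B/W. Since W is contained in B+ and in B-, the ideal quotients B+/W, B-/W and
   H/W are the full subcategories of B/W on the objects of B+, B- and H. *)
Definition stable : preadditive := quotient (base_additive C) cotW_add.

Definition stable_functor : functor C stable :=
  quotient_functor (base_additive C) cotW_add.

Definition stable_plus : preadditive := full (C := stable) Bplus.
Definition stable_minus : preadditive := full (C := stable) Bminus.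

Definition in_heart (B : C) : Prop := Bplus B /\ Bminus B.
Definition heart : preadditive := full (C := stable) in_heart.

Definition is_reflection (B Z : C) (z : hom B Z) : Prop :=
  [/\ Bplus Z, exists (X : C) (u : hom Z X), U X /\ conflation z u
    & forall Y, V Y -> forall d : ext B Y, exists d' : ext Z Y, pull z d' = d].

Definition is_coreflection (B X : C) (x : hom X B) : Prop :=
  [/\ Bminus X, exists (Y : C) (v : hom Y X), V Y /\ conflation v x
    & forall Z, U Z -> forall d : ext Z B, exists d' : ext Z X, push x d' = d].

End Heart.

(* [plus B] is the pair of B+ and p_B, [minus B] the pair of B- and m_B. *)
Record reflection_choice (C : extriangulated) (T : cotorsion_pair C) :=
  ReflectionChoice {
  plus : forall B : C, {Z : C & hom B Z};
  minus : forall B : C, {X : C & hom X B};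
  plusP : forall B, is_reflection T (projT2 (plus B));
  minusP : forall B, is_coreflection T (projT2 (minus B));
  plus_id : forall B, Bplus T B -> plus B = existT _ B (idm B);
  minus_id : forall B, Bminus T B -> minus B = existT _ B (idm B) }.

Section ReflectionLemmas.
Variables (C : extriangulated) (T : cotorsion_pair C).
Local Notation U := (cotU T).
Local Notation V := (cotV T).
Local Notation W := (cotW T).

Lemma reflection_ex (B Z Y : C) (z : hom B Z) (h : hom B Y) :
  is_reflection T z -> Bplus T Y -> exists g : hom Z Y, factors W (g \oc z - h).
Proof.
move=> [_ [X [u [UX [d hd]]]] zsurj] [V1 [W1 [v [w [VV1 [UW1 VW1] [e he]]]]]].
have [n hn] := zsurj _ VV1 (pull h e).
have vn0 : push v n = 0.
  have [|k ->] := ext_pull_exact (z := push v n) hd.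
    by rewrite -push_pull hn push_pull (push_inflation he) pull0.
  by rewrite (cot_ext T (k)) // pull0.
have [Y' [a [b hab]]] := realizes_ex n.
have [t ht] := hom_extend hab vn0.
have [|g [_]] := ET3 (a := idm V1) (b := t) hab he; first by rewrite compm1.
rewrite push1 => hg; exists g.
have [|l hl] := hom_lift (c := g \oc z - h) he.
  by rewrite pullBl pullM -hg hn subrr.
by exists W1, w, l; rewrite hl.
Qed.

Lemma reflection_uniq (B Z Y : C) (z : hom B Z) (g : hom Z Y) :
  is_reflection T z -> Bplus T Y -> factors W (g \oc z) -> factors W g.
Proof.
move=> [_ [X [u [UX [d hd]]]] _] [V1 [W1 [v [w [VV1 W1W [e he]]]]]].
case=> [W0 [k [l [[UW0 VW0] hkl]]]].
have [|m hm] := hom_extend (a := l) hd; first exact: (cot_ext T).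
have [|c hc] := hom_coextend (g := g - k \oc m) hd.
  by rewrite compBl hkl -compA hm subrr.
have [|c' hc'] := hom_lift (c := c) he; first exact: (cot_ext T).
rewrite -[g](subrK (k \oc m)) -hc -hc'; apply: factorsD.
- exact: base_additive.
- exact: cotW_add.
- by exists W1, w, (c' \oc u); rewrite compA.
- by exists W0, k, m.
Qed.

Lemma cotV_perp (B : C) : (forall X, U X -> forall d : ext X B, d = 0) -> V B.
Proof.
move=> h; have [V1 [U1 [x [y [VV1 UU1 [d hd]]]]]] := cot_right T B.
have [S [i1 [i2 [p1 [p2 hS]]]]] := (base_additive C).2 B U1.
have hS' := realizes_split hS; rewrite -(h _ UU1 d) in hS'.
have [b [b' [e1 e2 _ _]]] := (realizes_class i1 p2 hd).1 hS'.
apply: (cotV_summand hS); apply: (@cotV_iso _ _ V1) => //.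
by exists b, b'.
Qed.

Lemma cotV_extension (A B D : C) (x : hom A B) (y : hom B D) :
  conflation x y -> V A -> V D -> V B.
Proof.
move=> [d hd] VA VD; apply: cotV_perp => X UX z.
have [|w ->] := ext_push_exact (z := z) hd; first exact: (cot_ext T).
by rewrite (cot_ext T (w)) // push0.
Qed.

Lemma coreflection_Bplus (X Y : C) (x : hom X Y) :
  is_coreflection T x -> Bplus T Y -> Bplus T X.
Proof.
move=> [_ [V0 [a [VV0 [d hd]]]] _] [V1 [W1 [v [w [VV1 [UW1 VW1] [e he]]]]]].
have [P [c [b hP]]] := realizes_ex (pull x e).
have VP : V P.
  apply: cotV_perp => X' UX' t.
  have [|q hq] := hom_lift (c := x \oc b) he.
    by rewrite pullM (pull_deflation hP).
  have [|s hs] := ext_push_exact (z := push b t) hd.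
    by rewrite -pushM -hq pushM (cot_ext T (push q t)) // push0.
  have [|r ->] := ext_push_exact (z := t) hP.
    by rewrite hs (cot_ext T (s)) // push0.
  by rewrite (cot_ext T (r)) // push0.
have [V3 [U3 [f' [f [VV3 UU3 [d3 h3]]]]]] := cot_left T P.
have [E [k [l [h' [d' [_ _ hE hVE _]]]]]] := ET4op hP h3.
exists E, U3, h', (b \oc f); split; last by exists d'.
  by apply: (@cotV_extension _ _ _ l k) => //; eexists; exact: hVE.
split=> //; apply: (@cotV_extension _ _ _ f' f) => //; by exists d3.
Qed.

End ReflectionLemmas.

Program Definition op_cotorsion (C : extriangulated) (T : cotorsion_pair C) :
  cotorsion_pair (op_ext C) :=
  @CotorsionPair (op_ext C) (cotV T) (cotU T) _ _ _ _ _ _ _ _ _.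
Next Obligation.
move=> C T; have [h0 hS] := cotV_add T; split=> // A B S i1 i2 p1 p2 [*].
by apply: (hS _ _ _ p1 p2 i1 i2).
Qed.
Next Obligation.
move=> C T; have [h0 hS] := cotU_add T; split=> // A B S i1 i2 p1 p2 [*].
by apply: (hS _ _ _ p1 p2 i1 i2).
Qed.
Next Obligation.
move=> C T A B S i1 i2 p1 p2 [*].
by apply: (@cotV_summand _ T _ _ _ p1 p2 i1 i2).
Qed.
Next Obligation.
move=> C T A B S i1 i2 p1 p2 [*].
by apply: (@cotU_summand _ T _ _ _ p1 p2 i1 i2).
Qed.
Next Obligation.
by move=> C T A B [f [g [h1 h2]]]; apply: cotV_iso; exists g, f.
Qed.
Next Obligation.
by move=> C T A B [f [g [h1 h2]]]; apply: cotU_iso; exists g, f.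
Qed.
Next Obligation.
by move=> C T X Y d VX UY; exact: (@cot_ext C T Y X d UY VX).
Qed.
Next Obligation.
move=> C T B; have [X [Y [x [y [VX UY [d h]]]]]] := cot_right T B.
by exists Y, X, y, x; split=> //; exists d.
Qed.
Next Obligation.
move=> C T B; have [X [Y [x [y [VX UY [d h]]]]]] := cot_left T B.
by exists Y, X, y, x; split=> //; exists d.
Qed.

Section CoreflectionLemmas.
Variables (C : extriangulated) (T : cotorsion_pair C).
Local Notation W := (cotW T).

Lemma op_factors (A B : C) (f : hom A B) :
  factors (C := op_ext C) (cotW (op_cotorsion T)) (f : @hom (op C) B A) <->
  factors W f.
Proof.
split=> -[S [g [h [[h1 h2] e]]]]; exists S, h, g.
  by split; [split; [exact: h2 | exact: h1] | exact: e].
by split; [split; [exact: h2 | exact: h1] | exact: e].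
Qed.

Lemma op_Bplus (B : C) : Bplus (op_cotorsion T) B <-> Bminus T B.
Proof.
split=> [[X [Y [x [y [UX [VY UY] [d h]]]]]]|[X [Y [x [y [[UX VX] UY [d h]]]]]]].
  exists Y, X, y, x; split; last by exists d.
    by split; [exact: UY | exact: VY].
  exact: UX.
exists Y, X, y, x; split; last by exists d.
  exact: UY.
by split; [exact: VX | exact: UX].
Qed.

Lemma op_reflection (B X : C) (x : hom X B) :
  is_coreflection T x -> is_reflection (op_cotorsion T) (x : @hom (op C) B X).
Proof.
move=> [/op_Bplus hX [Y [v [VY [d h]]]] hs]; split=> //.
by exists Y, v; split=> //; exists d.
Qed.

Lemma coreflection_ex (B X Y : C) (x : hom X B) (h : hom Y B) :
  is_coreflection T x -> Bminus T Y ->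
  exists g : hom Y X, factors W (x \oc g - h).
Proof.
move=> /op_reflection hx /op_Bplus hY.
have [g hg] := @reflection_ex (op_ext C) (op_cotorsion T) B X Y x h hx hY.
by exists g; apply/op_factors.
Qed.

Lemma coreflection_uniq (B X Y : C) (x : hom X B) (g : hom Y X) :
  is_coreflection T x -> Bminus T Y -> factors W (x \oc g) -> factors W g.
Proof.
move=> /op_reflection hx /op_Bplus hY /op_factors hg.
apply/op_factors.
exact: (@reflection_uniq (op_ext C) (op_cotorsion T) B X Y x g hx hY hg).
Qed.

End CoreflectionLemmas.

Section Sigma.
Variables (C : extriangulated) (T : cotorsion_pair C).
Variable R : reflection_choice T.
Local Notation stable := (stable T).
Local Notation plus_obj B := (projT1 (plus R B)).
Local Notation minus_obj B := (projT1 (minus R B)).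

Definition unit_plus (B : C) : @hom stable B (plus_obj B) :=
  fmap (stable_functor T) (projT2 (plus R B)).

Definition counit_minus (B : C) : @hom stable (minus_obj B) B :=
  fmap (stable_functor T) (projT2 (minus R B)).

Lemma stable_eq (A B : C) (f g : hom A B) :
  fmap (stable_functor T) f = fmap (stable_functor T) g <->
  factors (cotW T) (f - g).
Proof. exact: qpi_eq. Qed.

Lemma stable_surj (A B : C) (f : @hom stable A B) :
  exists g : @hom C A B, f = fmap (stable_functor T) g.
Proof. exact: qpi_surj. Qed.

Lemma stableM (A B D : C) (g : hom B D) (f : hom A B) :
  @comp stable A B D (fmap (stable_functor T) g) (fmap (stable_functor T) f) =
  fmap (stable_functor T) (g \oc f).
Proof. by rewrite fmapM. Qed.

Lemma sigma_plus_subproof (A B : C) (f : @hom stable A B) :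
  exists! g : @hom stable (plus_obj A) (plus_obj B),
    g \oc unit_plus A = unit_plus B \oc f.
Proof.
have hA := plusP R A; have [hB _ _] := plusP R B.
have [f' ->] := stable_surj f.
have [g hg] := reflection_ex (projT2 (plus R B) \oc f') hA hB.
have e : fmap (stable_functor T) g \oc unit_plus A =
         unit_plus B \oc fmap (stable_functor T) f'.
  by rewrite /unit_plus !stableM; apply/stable_eq.
exists (fmap (stable_functor T) g); split=> // k; have [k' ->] := stable_surj k.
rewrite -e /unit_plus !stableM => /esym/stable_eq hk; apply/stable_eq.
by apply: (reflection_uniq hA hB); rewrite compBl.
Qed.

Lemma sigma_minus_subproof (A B : C) (f : @hom stable A B) :
  exists! g : @hom stable (minus_obj A) (minus_obj B),
    counit_minus B \oc g = f \oc counit_minus A.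
Proof.
have hB := minusP R B; have [hA _ _] := minusP R A.
have [f' ->] := stable_surj f.
have [g hg] := coreflection_ex (f' \oc projT2 (minus R A)) hB hA.
have e : counit_minus B \oc fmap (stable_functor T) g =
         fmap (stable_functor T) f' \oc counit_minus A.
  by rewrite /counit_minus !stableM; apply/stable_eq.
exists (fmap (stable_functor T) g); split=> // k; have [k' ->] := stable_surj k.
rewrite -e /counit_minus !stableM => /esym/stable_eq hk; apply/stable_eq.
by apply: (coreflection_uniq hB hA); rewrite compBr.
Qed.

Definition sigma_plus_hom (A B : C) (f : @hom stable A B) :
    @hom stable (plus_obj A) (plus_obj B) :=
  sval (cid (sigma_plus_subproof f)).

Definition sigma_minus_hom (A B : C) (f : @hom stable A B) :
    @hom stable (minus_obj A) (minus_obj B) :=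
  sval (cid (sigma_minus_subproof f)).

Lemma sigma_plusE (A B : C) (f : @hom stable A B) :
  sigma_plus_hom f \oc unit_plus A = unit_plus B \oc f.
Proof. by have [e _] := svalP (cid (sigma_plus_subproof f)). Qed.

Lemma sigma_plus_uniq (A B : C) (f : @hom stable A B) g :
  g \oc unit_plus A = unit_plus B \oc f -> g = sigma_plus_hom f.
Proof.
by move=> e; have [_ hk] := svalP (cid (sigma_plus_subproof f)); apply/esym/hk.
Qed.

Lemma sigma_minusE (A B : C) (f : @hom stable A B) :
  counit_minus B \oc sigma_minus_hom f = f \oc counit_minus A.
Proof. by have [e _] := svalP (cid (sigma_minus_subproof f)). Qed.

Lemma sigma_minus_uniq (A B : C) (f : @hom stable A B) g :
  counit_minus B \oc g = f \oc counit_minus A -> g = sigma_minus_hom f.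
Proof.
by move=> e; have [_ hk] := svalP (cid (sigma_minus_subproof f)); apply/esym/hk.
Qed.

Lemma plus_obj_Bplus (B : C) : Bplus T (plus_obj B).
Proof. by case: (plusP R B). Qed.

Lemma minus_obj_Bminus (B : C) : Bminus T (minus_obj B).
Proof. by case: (minusP R B). Qed.

Lemma sigma_plus1 (A : C) :
  sigma_plus_hom (@idm stable A) = @idm stable (plus_obj A).
Proof. by apply/esym/sigma_plus_uniq; rewrite comp1m compm1. Qed.

Lemma sigma_plusM (A B D : C) (g : @hom stable B D) (f : @hom stable A B) :
  sigma_plus_hom (g \oc f) = sigma_plus_hom g \oc sigma_plus_hom f.
Proof.
apply/esym/sigma_plus_uniq.
by rewrite -compA sigma_plusE compA sigma_plusE -compA.
Qed.

Lemma sigma_minus1 (A : C) :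
  sigma_minus_hom (@idm stable A) = @idm stable (minus_obj A).
Proof. by apply/esym/sigma_minus_uniq; rewrite comp1m compm1. Qed.

Lemma sigma_minusM (A B D : C) (g : @hom stable B D) (f : @hom stable A B) :
  sigma_minus_hom (g \oc f) = sigma_minus_hom g \oc sigma_minus_hom f.
Proof.
apply/esym/sigma_minus_uniq.
by rewrite compA sigma_minusE -compA sigma_minusE compA.
Qed.

Definition sigma_plus : functor stable (stable_plus T) :=
  @Functor stable (stable_plus T)
    (fun B => exist _ (plus_obj B) (plus_obj_Bplus B)) sigma_plus_hom
    sigma_plus1 sigma_plusM.

Definition sigma_minus : functor stable (stable_minus T) :=
  @Functor stable (stable_minus T)
    (fun B => exist _ (minus_obj B) (minus_obj_Bminus B)) sigma_minus_hom
    sigma_minus1 sigma_minusM.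

Definition sigma_composite : functor C stable :=
  fcomp (full_incl (C := stable) (Bminus T))
    (fcomp sigma_minus (fcomp (full_incl (C := stable) (Bplus T))
      (fcomp sigma_plus (stable_functor T)))).

Lemma sigma_composite_heart (B : C) : in_heart T (sigma_composite B).
Proof.
split; last exact: minus_obj_Bminus.
exact: coreflection_Bplus (minusP R _) (plus_obj_Bplus B).
Qed.

Definition heart_functor : functor C (heart T) :=
  full_lift sigma_composite_heart.

End Sigma.

(* Main.v *)
From mathcomp Require Import all_boot all_algebra.
Require Import Defs.

(** Everything is computed in the extriangulated category itself, with
morphisms taken modulo those factoring through [W] (called null below); a
statement about the heart is a statement about such classes. Two observations
make the functors [E(U0, -)], for [U0] in [U], the main tool. A null map acts
as zero on [E(U0, -)], because [E(U, V) = 0]; and a coreflection [X -> B]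
induces a bijection [E(U0, X) = E(U0, B)]. So, given a conflation
[B -> M -> U0], a map [g] from the coreflection of [B] to an object of [B+]
extends to the coreflection of [M] as soon as [g] kills the class of the
conflation, lifted along this bijection ([coreflection_hom_extend]), and the
extension is unique modulo [W] ([coreflection_hom_inj]).

The class of a reflection [B -> B+ -> U0] is pushed out from an object of [U]
([reflection_class]), and an object of [U] has only null maps into [B+]. Hence
[sigma-] of the unit [B -> B+], a map from the coreflection of [B] to [H(B)],
induces a bijection on maps into the heart: [H], defined as [sigma- sigma+], can
be computed on [sigma-].

The heart is abelian. Push the conflation [A -> W0 -> U0] of an object [A] of
[B-] out along [f : A -> B] to obtain [B -> M]; the cokernel of [f] is the
reflection of [M]. A monomorphism [f] of the heart is injective on [E(U0, -)]
([heart_mono_push_inj]), and this is what is needed to lift through [f] the maps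
killed by its cokernel. Kernels and epimorphisms are obtained in the opposite
extriangulated category.

For a conflation [A -x-> B -y-> D] choose a conflation [A -a-> V0 -> U0] with
[V0] in [V]. Push it out along [x] to obtain [m : B -> M]; then [H(m)] is a
cokernel of [H(x)], since maps into [V] die under [H]. Push the given conflation
out along [a] to obtain [V0 -> M' -> D]; then [H(M') -> H(D)] is a monomorphism,
by the dual of the uniqueness statement above. Since [M'] is a weak
pushout, [m] factors through [B -> M']. Hence a map killed by [H(y)] is killed by
[H(B) -> H(M')], so by [H(m)]: the kernel of the cokernel of [H(x)] is a kernel
of [H(y)]. *)

Set Implicit Arguments.
Unset Strict Implicit.
Unset Printing Implicit Defensive.

Import GRing.Theory.
Local Open Scope ring_scope.
Local Open Scope cat_scope.

(** * Weak pushout squares *)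

Section PushoutSquare.
Variable C : extriangulated.

(** The map [(x, -a) : A -> B + A'] is an inflation: it is the split inflation
[(1, -a) : A -> A + A'] followed by [x + 1], and its cone [M] is the sought
pushout. The two weak universal properties express that the conflation
[A -> B + A' -> M] is exact under [Hom]. *)
Lemma weak_pushout_square (A B D A' : C) (x : hom A B) (y : hom B D)
    (d : ext D A) (a : hom A A') :
  realizes x y d ->
  exists (M : C) (x' : hom A' M) (y' : hom M D) (b : hom B M),
    [/\ realizes x' y' (push a d), b \oc x = x' \oc a, y' \oc b = y,
        forall Y (s : hom B Y) (t : hom A' Y), s \oc x = t \oc a ->
          exists2 k : hom M Y, k \oc b = s & k \oc x' = t
      & forall Z (s : hom Z B) (t : hom Z A'), b \oc s = x' \oc t ->
          exists2 u : hom Z A, x \oc u = s & a \oc u = t].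
Proof.
move=> h; have [[O O0] bip] := base_additive C.
have [S [i1 [i2 [p1 [p2 hS]]]]] := bip A A'.
have [S' [j1 [j2 [q1 [q2 hS']]]]] := bip B A'.
have hD := biproductC (biproduct0l D O0).
have h1 := realizes_split (biproductC (biproduct0l A' O0)).
have := realizes_sum hS hS' hD h h1.
rewrite pull0 push0 pull1 addr0 comp1m comp0m compm1 comp0m addr0.
case: hS => p1i1 p2i2 p1i2 p2i1 iSp; case: hS' => q1j1 q2j2 q1j2 q2j1 _ hg.
set g := j1 \oc x \oc p1 + j2 \oc p2 in hg.
(* [f'] makes [f] and [i2] the injections of another decomposition of [S]. *)
pose f := i1 - i2 \oc a; pose f' := p2 + a \oc p1.
have hf : is_biproduct f i2 p1 f'.
  split; rewrite /f /f'.
  - by rewrite compBr p1i1 compA p1i2 comp0m subr0.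
  - by rewrite compDl p2i2 -compA p1i2 compm0 addr0.
  - by [].
  - rewrite compDl !compBr p2i1 !compA p2i2 -!compA p1i1 (compA p1) p1i2.
    by rewrite comp0m compm0 compm1 comp1m sub0r subr0 addNr.
  - by rewrite compBl compDr -iSp (addrC (i2 \oc p2)) addrA compA subrK.
have [M [x' [y' [k [d3 [kg yk hM hx' _]]]]]] := ET4 (realizes_split hf) hg.
have f'i1 : f' \oc i1 = a by rewrite compDl p2i1 -compA p1i1 compm1 add0r.
have gi1 : g \oc i1 = j1 \oc x.
  by rewrite compDl -!compA p1i1 p2i1 compm0 compm1 addr0.
have gi2 : g \oc i2 = j2.
  by rewrite compDl -!compA p1i2 p2i2 !compm0 compm1 add0r.
have kj2 : k \oc j2 = x'.
  by rewrite -gi2 compA kg -compA compDl -compA p1i2 p2i2 compm0 addr0 compm1.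
have gf : g \oc f = j1 \oc x - j2 \oc a by rewrite compBr gi1 compA gi2.
rewrite gf in hM; exists M, x', y', (k \oc j1); split.
- by rewrite -f'i1 pushM.
- by rewrite -compA -gi1 compA kg -compA f'i1.
- by rewrite compA yk -compA q1j1 compm1.
- move=> Y s t st.
  have [|l hl] := hom_coextend (g := s \oc q1 + t \oc q2) hM.
    rewrite compDl !compBr -!compA (compA q1) (compA q1) (compA q2) (compA q2).
    by rewrite q1j1 q1j2 q2j1 q2j2 !comp0m !comp1m !compm0 subr0 sub0r st subrr.
  exists l.
    by rewrite compA hl compDl -!compA q1j1 q2j1 compm0 compm1 addr0.
  by rewrite -kj2 compA hl compDl -!compA q1j2 q2j2 compm0 compm1 add0r.
- move=> Z s t st.
  have [|u hu] := hom_colift (g := j1 \oc s - j2 \oc t) hM.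
    by rewrite compBr !compA kj2 st subrr.
  exists u.
    have := congr1 (comp q1) hu; rewrite compBl !compBr !compA q1j1 q1j2.
    by rewrite !comp0m !comp1m !subr0.
  have := congr1 (comp q2) hu; rewrite compBl !compBr !compA q2j1 q2j2.
  by rewrite !comp0m !comp1m !sub0r => /oppr_inj.
Qed.

End PushoutSquare.

(** * Null maps, and the objects of B+ and B- *)

Section NullMaps.
Variables (C : extriangulated) (T : cotorsion_pair C).
Local Notation U := (cotU T).
Local Notation V := (cotV T).
Local Notation W := (cotW T).
Local Notation nul := (factors W).

Lemma nulD (A B : C) (f g : hom A B) : nul f -> nul g -> nul (f + g).
Proof. exact: factorsD (base_additive C) (cotW_add T). Qed.

Lemma nulB (A B : C) (f g : hom A B) : nul f -> nul g -> nul (f - g).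
Proof. by move=> hf hg; apply: nulD => //; apply: factorsN. Qed.

Lemma nul0 (A B : C) : nul (0 : hom A B).
Proof. exact: factors0 (base_additive C) (cotW_add T). Qed.

Lemma nul_congr (A B : C) (f g : hom A B) : nul (f - g) -> nul g -> nul f.
Proof. by move=> h hg; rewrite -(subrK g f); apply: nulD. Qed.

Lemma push_nul (X A B : C) (f : hom A B) (d : ext X A) :
  U X -> nul f -> push f d = 0.
Proof.
move=> UX [S [g [h [[_ VS] ->]]]].
by rewrite pushM (cot_ext T (push h d)) // push0.
Qed.

Lemma pull_nul (X A B : C) (f : hom A B) (d : ext B X) :
  V X -> nul f -> pull f d = 0.
Proof.
move=> VX [S [g [h [[US _] ->]]]].
by rewrite pullM (cot_ext T (pull g d)) // pull0.
Qed.

Lemma push_congr (X A B : C) (f g : hom A B) (d : ext X A) :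
  U X -> nul (f - g) -> push f d = push g d.
Proof.
by move=> UX h; rewrite -(subrK g f) pushDl (push_nul _ UX h) add0r.
Qed.

Lemma pull_congr (X A B : C) (f g : hom A B) (d : ext B X) :
  V X -> nul (f - g) -> pull f d = pull g d.
Proof.
by move=> VX h; rewrite -(subrK g f) pullDl (pull_nul _ VX h) add0r.
Qed.

(** In a conflation [V1 -> U1 -> Y] with [U1] in [U], the middle term is also in
[V], hence in [W], and maps from [U] lift to it. *)
Lemma nul_UV (X Y : C) (f : hom X Y) : U X -> V Y -> nul f.
Proof.
move=> UX VY; have [V1 [U1 [x [y [VV1 UU1 [d hd]]]]]] := cot_left T Y.
have [|g hg] := hom_lift (c := f) hd; first exact: (cot_ext T).
exists U1, y, g; split=> //; split=> //.
by apply: (cotV_extension (T := T) (x := x) (y := y)) => //; exists d.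
Qed.

Lemma Bplus_nul (X B : C) (f : hom X B) : U X -> Bplus T B -> nul f.
Proof.
move=> UX [V1 [W1 [v [w [VV1 W1W [d hd]]]]]].
have [|g hg] := hom_lift (c := f) hd; first exact: (cot_ext T).
by exists W1, w, g.
Qed.

(** If [U1 -> B] is null, then the identity of [U1] is a sum of a map through
[V1] and a map through [W], so that [E(X, U1) = 0] for [X] in [U]. Together with
[Bplus_nul] this characterizes [B+] by a vanishing of stable morphisms, which
makes its closure properties immediate. *)
Lemma Bplus_of_nul (B : C) :
  (forall X (f : hom X B), U X -> nul f) -> Bplus T B.
Proof.
move=> h; have [V1 [U1 [v [y [VV1 UU1 [d hd]]]]]] := cot_left T B.
exists V1, U1, v, y; split=> //; last by exists d.
split=> //; have [W1 [c [g [[UW1 VW1] yE]]]] := h _ y UU1.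
have [|c' hc] := hom_lift (c := c) hd; first exact: (cot_ext T).
have [|e he] := hom_colift (g := idm U1 - c' \oc g) hd.
  by rewrite compBr compm1 compA hc -yE subrr.
apply: (cotV_perp (T := T)) => X UX z.
rewrite -[z]push1 -(subrK (c' \oc g) (idm U1)) -he pushDl !pushM.
by rewrite (cot_ext T (push e z)) // (cot_ext T (push g z)) // !push0 addr0.
Qed.

Lemma Bplus_extension (V0 E B : C) (v : hom V0 E) (e : hom E B) :
  conflation v e -> V V0 -> Bplus T B -> Bplus T E.
Proof.
move=> [d hd] VV0 hB; apply: Bplus_of_nul => X f UX.
have [W1 [k [g [[UW1 VW1] ef]]]] := Bplus_nul (e \oc f) UX hB.
have [|k' hk] := hom_lift (c := k) hd; first exact: (cot_ext T).
have [|a ha] := hom_colift (g := f - k' \oc g) hd.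
  by rewrite compBr compA hk ef subrr.
apply: (@nul_congr _ _ f (k' \oc g)); last by exists W1, k', g.
by rewrite -ha; apply: factors_compl; apply: nul_UV.
Qed.

(** Correcting [h] by a map through [W] that extends to [M], one may assume
[h m = 0]; then [h] factors through [X], and maps from [U] to [B+] are null. *)
Lemma hom_ext_nul (B M X Y : C) (m : hom B M) (r : hom M X) (h : hom M Y) :
  conflation m r -> U X -> Bplus T Y -> nul (h \oc m) -> nul h.
Proof.
move=> [d hd] UX hY [W1 [k [l [[UW1 VW1] hm]]]].
have [|l' hl] := hom_extend (a := l) hd; first exact: (cot_ext T).
have [|c hc] := hom_coextend (g := h - k \oc l') hd.
  by rewrite compBl hm -compA hl subrr.
apply: (@nul_congr _ _ h (k \oc l')); last by exists W1, k, l'.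
by rewrite -hc; apply: factors_compr; apply: Bplus_nul.
Qed.

End NullMaps.

(** * Passage to the opposite category *)

Section Duality.
Variables (C : extriangulated) (T : cotorsion_pair C).

Lemma op_Bminus (B : C) : Bminus (op_cotorsion T) B <-> Bplus T B.
Proof.
split=> [[X [Y [x [y [[VX UX] VY [d h]]]]]]|[X [Y [x [y [VX [UY VY] [d h]]]]]]].
  by exists Y, X, y, x; split; [exact: VY | split; [exact: UX | exact: VX] |
    exists d].
by exists Y, X, y, x; split; [split; [exact: VY | exact: UY] | exact: VX |
  exists d].
Qed.

Lemma op_in_heart (B : C) : in_heart (op_cotorsion T) B <-> in_heart T B.
Proof. by split=> -[h1 h2]; split; first [apply/op_Bplus|apply/op_Bminus]. Qed.

Lemma op_coreflection (B Z : C) (z : hom B Z) :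
  is_reflection T z ->
  is_coreflection (op_cotorsion T) (z : @hom (op C) Z B).
Proof.
move=> [hZ [X [u [UX [d h]]]] hs]; split; first exact/op_Bminus.
  by exists X, u; split=> //; exists d.
exact: hs.
Qed.

Lemma Bminus_nul (B Y : C) (f : hom B Y) :
  Bminus T B -> cotV T Y -> factors (cotW T) f.
Proof.
move=> /op_Bplus hB VY; apply/op_factors.
exact: (@Bplus_nul (op_ext C) (op_cotorsion T) Y B f VY hB).
Qed.

Lemma Bminus_of_nul (B : C) :
  (forall Y (f : hom B Y), cotV T Y -> factors (cotW T) f) -> Bminus T B.
Proof.
move=> h; apply/op_Bplus; apply: Bplus_of_nul => X f VX.
by apply/op_factors; exact: h.
Qed.

Lemma Bminus_extension (B E U0 : C) (e : hom B E) (u : hom E U0) :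
  conflation e u -> Bminus T B -> cotU T U0 -> Bminus T E.
Proof.
move=> [d hd] /op_Bplus hB UU0; apply/op_Bplus.
apply: (@Bplus_extension (op_ext C) (op_cotorsion T) U0 E B u e) => //.
by exists d.
Qed.

End Duality.

(** * Coreflections along a conflation with cone in U *)

Section Coreflections.
Variables (C : extriangulated) (T : cotorsion_pair C).
Local Notation U := (cotU T).
Local Notation V := (cotV T).
Local Notation W := (cotW T).
Local Notation nul := (factors W).

(** The kernel of a coreflection is in [V], so [E(U0, -)] vanishes on it. *)
Lemma coreflection_push_inj (B X U0 : C) (c : hom X B) (d d' : ext U0 X) :
  is_coreflection T c -> U U0 -> push c d = push c d' -> d = d'.
Proof.
move=> [_ [V0 [v [VV0 [n hn]]]] _] UU0 e.
have [|w hw] := ext_push_exact (z := d - d') hn.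
  by apply: (addIr (push c d')); rewrite -pushD subrK add0r.
by apply/eqP; rewrite -subr_eq0 hw (cot_ext T w) // push0.
Qed.

(** Maps from [B-] lift to the coreflection up to null maps, and null maps do not
see extensions by [V]: so every map from [B-] to [B] lifts strictly. *)
Lemma coreflection_pull0 (B X D V0 : C) (c : hom X B) (v : hom V0 X)
    (n : ext B V0) (f : hom D B) :
  is_coreflection T c -> V V0 -> realizes v c n -> Bminus T D -> pull f n = 0.
Proof.
move=> hc VV0 hn hD; have [g hg] := coreflection_ex f hc hD.
by rewrite -(pull_congr _ VV0 hg) pullM (pull_deflation hn) pull0.
Qed.

(** [P] is the pullback of the coreflection of [M] along [m]. It has the
universal property of a coreflection of [B], and it sits in a conflation
[P -> XM -> U0] over the given one; [i] and [j] compare it with the coreflection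
[XB], and the class of that conflation corresponds to the lift of [b] to
[E(U0, XB)]. *)
Lemma coreflection_pullback (B M X U0 XB XM : C) (m : hom B M) (r : hom M U0)
    (b : ext U0 B) (cB : hom XB B) (cM : hom XM M) (mm : hom XB XM) :
  realizes m r b -> U U0 -> is_coreflection T cB -> is_coreflection T cM ->
  nul (cM \oc mm - m \oc cB) ->
  exists (P : C) (p : hom P XM) (q : hom XM U0) (d : ext U0 P)
      (i : hom P XB) (j : hom XB P),
    [/\ realizes p q d, nul (mm \oc i - p), nul (i \oc j - idm XB)
      & forall b', push cB b' = b -> push i d = b'].
Proof.
move=> hm UU0 hB hM hmm; have [hXM [V0 [v [VV0 [n hn]]]] _] := hM.
have [P [d [e [p [z [cp _ hp hd [dz _]]]]]]] := ET4op hm hn.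
have hP : Bminus T P.
  apply: Bminus_of_nul => Y f VY.
  have [|g <-] := hom_extend (a := f) hp; first exact: (cot_ext T).
  by apply: factors_compr; apply: (Bminus_nul g hXM VY).
have [i hi] := coreflection_ex d hB hP.
have [|j hj] := hom_lift (c := cB) hd.
  by rewrite -pullM; apply: (coreflection_pull0 _ hM VV0 hn); case: hB.
exists P, p, (r \oc cM), z, i, j; split=> //.
- apply: (coreflection_uniq hM hP); rewrite compBr cp.
  have -> : cM \oc (mm \oc i) - m \oc d =
      (cM \oc mm - m \oc cB) \oc i + m \oc (cB \oc i - d).
    by rewrite compBl compBr !compA addrA subrK.
  by apply: nulD; [apply: factors_compr | apply: factors_compl].
- have [hXB _ _] := hB; apply: (coreflection_uniq hB hXB).
  rewrite compBr compm1 compA -{2}hj -compBl.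
  exact: factors_compr.
- move=> b' hb'; apply: (coreflection_push_inj hB UU0).
  by rewrite hb' -pushM (push_congr _ UU0 hi).
Qed.

(** Modulo [W] the map [mm] is the inflation [p : P -> XM], whose cone is in
[U]. *)
Lemma coreflection_hom_inj (B M U0 XB XM Y : C) (m : hom B M) (r : hom M U0)
    (cB : hom XB B) (cM : hom XM M) (mm : hom XB XM) (h : hom XM Y) :
  conflation m r -> U U0 -> is_coreflection T cB -> is_coreflection T cM ->
  nul (cM \oc mm - m \oc cB) -> Bplus T Y -> nul (h \oc mm) -> nul h.
Proof.
move=> [b hm] UU0 hB hM hmm hY hh.
have [P [p [q [d [i [j [hp mi _ _]]]]]]] :=
  coreflection_pullback XB hm UU0 hB hM hmm.
apply: (@hom_ext_nul _ T _ _ _ _ p q) => //; first by exists d.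
have -> : h \oc p = h \oc mm \oc i - h \oc (mm \oc i - p).
  by rewrite compBr compA opprB addrC subrK.
by apply: nulB; [apply: factors_compr | apply: factors_compl].
Qed.

(** Up to the identification of [XB] with [P], the map [mm] is the inflation
[P -> XM] and [b'] is its class, the obstruction to extending [g]. *)
Lemma coreflection_hom_extend (B M U0 XB XM Y : C) (m : hom B M) (r : hom M U0)
    (b' : ext U0 XB) (cB : hom XB B) (cM : hom XM M) (mm : hom XB XM)
    (g : hom XB Y) :
  realizes m r (push cB b') -> U U0 ->
  is_coreflection T cB -> is_coreflection T cM ->
  nul (cM \oc mm - m \oc cB) -> push g b' = 0 ->
  exists h : hom XM Y, nul (h \oc mm - g).
Proof.
move=> hm UU0 hB hM hmm hg.
have [P [p [q [d [i [j [hp mi ij di]]]]]]] :=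
  coreflection_pullback XB hm UU0 hB hM hmm.
have [|h hh] := hom_extend (a := g \oc i) hp.
  by rewrite pushM (di b').
exists h.
have -> : h \oc mm - g =
    h \oc (mm \oc i - p) \oc j - (h \oc mm - g) \oc (i \oc j - idm XB).
  rewrite !compBr !compBl hh !compm1 !compA.
  by rewrite subKr.
by apply: nulB; [apply/factors_compr/factors_compl | apply: factors_compl].
Qed.

(** The surjectivity in the definition of a reflection lifts the class of
[V1 -> U1 -> B] to [Z]; the resulting deflation [N -> Z] composed with
[Z -> U0] has kernel isomorphic to [U1], and pushing its class out to [B] gives
back the class of the reflection. *)
Lemma reflection_class (B Z : C) (z : hom B Z) :
  is_reflection T z ->
  exists (U0 E : C) (q : hom Z U0) (u : hom E B) (e : ext U0 E),
    [/\ U U0, U E & realizes z q (push u e)].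
Proof.
move=> [_ [U0 [q [UU0 [b hb]]]] hs].
have [V1 [U1 [v [y [VV1 UU1 [n hn]]]]]] := cot_left T B.
have [n' hn'] := hs _ VV1 n.
have [N [s [t hN]]] := realizes_ex n'.
have [E [d [e [k [d3 [_ _ _ hE [hd3 _]]]]]]] := ET4op hb hN.
rewrite hn' in hE; have [f [f' [ff' f'f _ _]]] := (realizes_class _ _ hn).1 hE.
exists U0, E, q, d, d3; split=> //; last by rewrite hd3.
by apply: (cotU_iso (c := T) (A := U1)) => //; exists f, f'.
Qed.

End Coreflections.

(** * Cokernels and monomorphisms in the heart *)

Definition enough_reflections (C : extriangulated) (T : cotorsion_pair C) :=
  forall B : C, exists (Z : C) (z : hom B Z), is_reflection T z.

Definition enough_coreflections (C : extriangulated) (T : cotorsion_pair C) :=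
  forall B : C, exists (X : C) (x : hom X B), is_coreflection T x.

(** [c] represents a cokernel of [f] in the heart. Existence and uniqueness of
the factorization are separated, as each is a condition on null maps in [C]
itself, where the opposite category is available. *)
Definition heart_cokernel (C : extriangulated) (T : cotorsion_pair C)
    (A B Q : C) (f : hom A B) (c : hom B Q) : Prop :=
  [/\ factors (cotW T) (c \oc f),
      forall (Y : C) (t : hom B Y), in_heart T Y ->
        factors (cotW T) (t \oc f) ->
        exists s : hom Q Y, factors (cotW T) (s \oc c - t)
    & forall (Y : C) (s : hom Q Y), in_heart T Y ->
        factors (cotW T) (s \oc c) -> factors (cotW T) s].

Definition heart_kernel (C : extriangulated) (T : cotorsion_pair C)
    (A B K : C) (f : hom A B) (k : hom K A) : Prop :=
  [/\ factors (cotW T) (f \oc k),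
      forall (X : C) (t : hom X A), in_heart T X ->
        factors (cotW T) (f \oc t) ->
        exists s : hom X K, factors (cotW T) (k \oc s - t)
    & forall (X : C) (s : hom X K), in_heart T X ->
        factors (cotW T) (k \oc s) -> factors (cotW T) s].

Section HeartC.
Variables (C : extriangulated) (T : cotorsion_pair C).
Local Notation U := (cotU T).
Local Notation V := (cotV T).
Local Notation W := (cotW T).
Local Notation nul := (factors W).
Hypothesis refl : enough_reflections T.

Lemma reflection_Bminus (B Z : C) (z : hom B Z) :
  is_reflection T z -> Bminus T B -> Bminus T Z.
Proof.
by move=> [_ [X [u [UX hz]]] _] hB; apply: Bminus_extension hz hB UX.
Qed.

Lemma coreflection_in_heart (X B : C) (x : hom X B) :
  is_coreflection T x -> Bplus T B -> in_heart T X.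
Proof.
move=> [hX [V0 [v [VV0 hx]]] _] hB; split=> //.
exact: Bplus_extension hx VV0 hB.
Qed.

(** Pushing [A -> W0 -> U0] out along [f] yields the universal map from [B] into
objects of [B+] that kills [f]; the pushout stays in [B-], and reflecting it
reaches the heart. *)
Lemma heart_cokernel_ex (A B : C) (f : hom A B) :
  in_heart T A -> in_heart T B ->
  exists (Q : C) (c : hom B Q), in_heart T Q /\ heart_cokernel T f c.
Proof.
move=> [_ [W0 [U0 [a [y [W0W UU0 [d hd]]]]]]] [_ hB].
have [M [m [r [w [hm wa _ _ _]]]]] := weak_pushout_square f hd.
have [Z [p hp]] := refl M; have [hZ _ _] := hp.
have hM : Bminus T M.
  by apply: Bminus_extension hB UU0; exists (push f d); exact: hm.
exists Z, (p \oc m); split; first by split=> //; exact: reflection_Bminus hp hM.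
split.
- by rewrite -compA -wa compA; exists W0, (p \oc w), a.
- move=> Y t [hY _] htf.
  have [|s' hs] := hom_extend (a := t) hm.
    by rewrite -pushM (push_nul _ UU0).
  have [s hss] := reflection_ex s' hp hY; exists s.
  by rewrite compA -hs -compBl; apply: factors_compr.
- move=> Y s [hY _]; rewrite compA => hs; apply: (reflection_uniq hp hY).
  by apply: hom_ext_nul hs => //; [exists (push f d); exact: hm | exact: UU0].
Qed.

Hypothesis corefl : enough_coreflections T.

Definition heart_mono (A B : C) (f : hom A B) : Prop :=
  forall (X : C) (t : hom X A), in_heart T X -> nul (f \oc t) -> nul t.

(** If [push f d = 0], then [d] comes from [E(X, E)], where [E] is the pullback
of [W1 -> B] along [f], hence from [E(X, Y)] for the coreflection [Y] of [E].
Now [Y] is in the heart and [Y -> E -> A] is killed by [f] modulo [W], so it is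
null. *)
Lemma heart_mono_push_inj (A B X : C) (f : hom A B) (d : ext X A) :
  in_heart T A -> in_heart T B -> heart_mono f -> U X -> push f d = 0 -> d = 0.
Proof.
move=> [hA _] [[V1 [W1 [v [w [VV1 W1W [e he]]]]]] _] fmono UX fd.
have [L [a [r hL]]] := realizes_ex d.
have [l hl] := hom_extend hL fd.
have [N [n [p hN]]] := realizes_ex (pull l e).
have [E [k [n' [h [d' [_ _ _ hE [kd _]]]]]]] := ET4op hL hN.
rewrite -pullM hl in hE.
have [|g hg] := hom_lift (c := f \oc k) he.
  by rewrite pullM (pull_deflation hE).
have [Y [c hc]] := corefl E; have [hY _ cs] := hc.
have [d'' hd] := cs _ UX d'.
have kc : nul (k \oc c).
  apply: fmono; last by exists W1, w, (g \oc c); rewrite !compA hg.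
  apply: (coreflection_in_heart hc).
  by apply: Bplus_extension VV1 hA; exists (pull f e); exact: hE.
by rewrite -kd -hd -pushM (push_nul _ UX kc).
Qed.

(** Let [t : X -> B] be killed by the cokernel [p m] of [f]. Then [m t] factors
through a map [u : U1 -> M] with [U1] in [U]. By the injectivity of [push f],
[u] comes from [B + W0], so that after a change of [t] by a map through [U1] the
weak pullback property applies. *)
Lemma heart_mono_kernel (A B : C) (f : hom A B) :
  in_heart T A -> in_heart T B -> heart_mono f ->
  exists (Q : C) (c : hom B Q), in_heart T Q /\ heart_kernel T c f.
Proof.
move=> hA hB fmono; have [_ [W0 [U0 [a [y [W0W UU0 [d hd]]]]]]] := hA.
have [M [m [r [w [hm wa rw _ pb]]]]] := weak_pushout_square f hd.
have [Z [p hp]] := refl M; have [hZ _ ps] := hp.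
have hM : Bminus T M.
  by apply: Bminus_extension hB.2 UU0; exists (push f d); exact: hm.
exists Z, (p \oc m); split; first by split=> //; exact: reflection_Bminus hp hM.
split=> // [|X t hX ct].
  by rewrite -compA -wa compA; exists W0, (p \oc w), a.
have [V1 [U1 [v [u [VV1 UU1 [n hn]]]]]] := cot_left T M.
have [n' hn'] := ps _ VV1 n.
(* [n] extends along the reflection [p], and [p m t] is null. *)
have [|x1 hx1] := hom_lift (c := m \oc t) hn.
  by rewrite -hn' -pullM compA (pull_nul _ VV1 ct).
have [|c0 hc0] := hom_lift (c := r \oc u) hd.
  apply: (heart_mono_push_inj hA hB fmono UU1).
  by rewrite push_pull pullM (pull_deflation hm) pull0.
have [|b0 hb0] := hom_colift (g := u - w \oc c0) hm.
  by rewrite compBr compA rw hc0 subrr.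
have [|s _ hs] := pb X (c0 \oc x1) (t - b0 \oc x1).
  by rewrite compBr -hx1 !compA hb0 -compBl opprB addrC subrK.
exists s; rewrite hs addrC addKr -compNl.
by apply/factors_compr/(Bplus_nul _ UU1 hB.1).
Qed.

End HeartC.

(** * The dual statements *)

Section HeartDual.
Variables (C : extriangulated) (T : cotorsion_pair C).
Local Notation U := (cotU T).
Local Notation V := (cotV T).
Local Notation W := (cotW T).
Local Notation nul := (factors W).

Lemma op_enough_reflections :
  enough_coreflections T -> enough_reflections (op_cotorsion T).
Proof.
by move=> h B; have [X [x hx]] := h B; exists X, x; exact: op_reflection.
Qed.

Lemma op_enough_coreflections :
  enough_reflections T -> enough_coreflections (op_cotorsion T).
Proof.
by move=> h B; have [X [x hx]] := h B; exists X, x; exact: op_coreflection.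
Qed.

Lemma op_heart_cokernel (A B K : C) (f : hom A B) (k : hom K A) :
  heart_cokernel (op_cotorsion T) (f : @hom (op C) B A) (k : @hom (op C) A K) ->
  heart_kernel T f k.
Proof.
move=> [/op_factors h1 h2 h3]; split=> // [X t /op_in_heart hX /op_factors ht|].
  by have [s /op_factors hs] := h2 X t hX ht; exists s.
move=> X s /op_in_heart hX /op_factors hs; apply/op_factors.
exact: (h3 X s hX hs).
Qed.

Lemma op_heart_kernel (A B Q : C) (f : hom A B) (c : hom B Q) :
  heart_kernel (op_cotorsion T) (f : @hom (op C) B A) (c : @hom (op C) Q B) ->
  heart_cokernel T f c.
Proof.
move=> [/op_factors h1 h2 h3]; split=> // [X t /op_in_heart hX /op_factors ht|].
  by have [s /op_factors hs] := h2 X t hX ht; exists s.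
move=> X s /op_in_heart hX /op_factors hs; apply/op_factors.
exact: (h3 X s hX hs).
Qed.

Lemma heart_kernel_ex (A B : C) (f : hom A B) :
  enough_coreflections T -> in_heart T A -> in_heart T B ->
  exists (K : C) (k : hom K A), in_heart T K /\ heart_kernel T f k.
Proof.
move=> /op_enough_reflections hr /op_in_heart hA /op_in_heart hB.
have [K [k [/op_in_heart hK /op_heart_cokernel hk]]] :=
  @heart_cokernel_ex (op_ext C) _ hr B A f hB hA.
by exists K, k.
Qed.

Lemma heart_epi_cokernel (A B : C) (f : hom A B) :
  enough_reflections T -> enough_coreflections T ->
  in_heart T A -> in_heart T B ->
  (forall (Y : C) (t : hom B Y), in_heart T Y -> nul (t \oc f) -> nul t) ->
  exists (K : C) (k : hom K A), in_heart T K /\ heart_cokernel T k f.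
Proof.
move=> /op_enough_coreflections hc /op_enough_reflections hr.
move=> /op_in_heart hA /op_in_heart hB fepi.
have fmono : heart_mono (op_cotorsion T) (f : @hom (op C) B A).
  move=> Y t /op_in_heart hY /op_factors ht.
  by apply/op_factors; exact: fepi.
have [K [k [/op_in_heart hK /op_heart_kernel hk]]] :=
  heart_mono_kernel hr hc hB hA fmono.
by exists K, k.
Qed.

(** The dual of [coreflection_hom_inj]. *)
Lemma reflection_hom_inj (V0 M D ZM ZD X : C) (v : hom V0 M) (q : hom M D)
    (zM : hom M ZM) (zD : hom D ZD) (qq : hom ZM ZD) (t : hom X ZM) :
  conflation v q -> V V0 -> is_reflection T zM -> is_reflection T zD ->
  nul (qq \oc zM - zD \oc q) -> Bminus T X -> nul (qq \oc t) -> nul t.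
Proof.
move=> [d hd] VV0 /op_coreflection hM /op_coreflection hD /op_factors hq.
move=> /op_Bplus hX /op_factors ht; apply/op_factors.
apply: (@coreflection_hom_inj (op_ext C) (op_cotorsion T) D M V0 ZD ZM X q v
  zD zM qq t) => //.
by exists d.
Qed.

End HeartDual.

(** * The heart is abelian *)

Section HeartAbelian.
Variables (C : extriangulated) (T : cotorsion_pair C).
Local Notation W := (cotW T).
Local Notation nul := (factors W).
Local Notation stable := (stable T).
Local Notation pi := (fmap (stable_functor T)).

Lemma stableD (A B : C) (f g : hom A B) : pi (f + g) = pi f + pi g.
Proof. exact: qpiD. Qed.

Lemma stable0 (A B : C) : pi (0 : hom A B) = 0.
Proof. by apply: (addrI (pi 0)); rewrite -stableD !addr0. Qed.

Lemma stable_eq0 (A B : C) (f : hom A B) : pi f = 0 <-> nul f.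
Proof. by rewrite -stable0 stable_eq subr0. Qed.

Lemma heartM (A B D : heart T) (g : @hom C (sval B) (sval D))
    (f : @hom C (sval A) (sval B)) :
  @comp (heart T) A B D (pi g) (pi f) = pi (g \oc f).
Proof. exact: stableM. Qed.

Lemma heart_is_kernel (A B K : heart T) (f : @hom C (sval A) (sval B))
    (k : @hom C (sval K) (sval A)) :
  heart_kernel T f k ->
  @is_kernel (heart T) A B K (pi f : @hom (heart T) A B) (pi k).
Proof.
move=> [h1 h2 h3]; split; first by rewrite heartM; apply/stable_eq0.
move=> [X hX] t; have [t' ->] := stable_surj (t : @hom stable X (sval A)).
rewrite (heartM (A := exist _ X hX)) => /stable_eq0/(h2 _ _ hX)[s hs].
exists (pi s); split=> [|s1]; first by rewrite heartM; apply/stable_eq.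
have [s' ->] := stable_surj (s1 : @hom stable X (sval K)).
rewrite heartM => /stable_eq hs'; apply/stable_eq/(h3 _ _ hX).
have -> : k \oc (s - s') = (k \oc s - t') - (k \oc s' - t').
  by rewrite compBr opprB addrA subrK.
exact: nulB.
Qed.

Lemma heart_is_cokernel (A B Q : heart T) (f : @hom C (sval A) (sval B))
    (c : @hom C (sval B) (sval Q)) :
  heart_cokernel T f c ->
  @is_cokernel (heart T) A B Q (pi f : @hom (heart T) A B) (pi c).
Proof.
move=> [h1 h2 h3]; split; first by rewrite heartM; apply/stable_eq0.
move=> [X hX] t; have [t' ->] := stable_surj (t : @hom stable (sval B) X).
rewrite (heartM (D := exist _ X hX)) => /stable_eq0/(h2 _ _ hX)[s hs].
exists (pi s); split=> [|s1]; first by rewrite heartM; apply/stable_eq.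
have [s' ->] := stable_surj (s1 : @hom stable (sval Q) X).
rewrite heartM => /stable_eq hs'; apply/stable_eq/(h3 _ _ hX).
have -> : (s - s') \oc c = (s \oc c - t') - (s' \oc c - t').
  by rewrite compBl opprB addrA subrK.
exact: nulB.
Qed.

Lemma in_heart_zero (Z : C) : is_zero Z -> in_heart T Z.
Proof.
move=> Z0; split.
  apply: Bplus_of_nul => X f _; rewrite -[f]comp1m Z0 comp0m; exact: nul0.
apply: Bminus_of_nul => X f _; rewrite -[f]compm1 Z0 compm0; exact: nul0.
Qed.

Lemma in_heart_biproduct (A B S : C) (i1 : hom A S) (i2 : hom B S) p1 p2 :
  is_biproduct i1 i2 p1 p2 -> in_heart T A -> in_heart T B -> in_heart T S.
Proof.
move=> [_ _ _ _ e] [pA mA] [pB mB]; split.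
  apply: Bplus_of_nul => X f UX; rewrite -[f]comp1m -e compDl -!compA.
  by apply: nulD; apply: factors_compl; apply: Bplus_nul.
apply: Bminus_of_nul => X f VX; rewrite -[f]compm1 -e compDr !compA.
by apply: nulD; apply: factors_compr; apply: Bminus_nul.
Qed.

Lemma heart_additive : is_additive (heart T).
Proof.
have [[Z Z0] bip] := base_additive C; split.
  exists (exist _ Z (in_heart_zero Z0)).
  have e : pi (idm Z) = 0 by rewrite Z0 stable0.
  exact: e.
move=> [A hA] [B hB]; have [S [i1 [i2 [p1 [p2 hS]]]]] := bip A B.
exists (exist _ S (in_heart_biproduct hS hA hB)), (pi i1), (pi i2).
exists (pi p1), (pi p2); case: hS => h1 h2 h3 h4 h5.
have e5 : pi i1 \oc pi p1 + pi i2 \oc pi p2 = pi (idm S).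
  by rewrite !stableM -stableD h5.
split; [| | | | exact: e5].
- exact: (etrans (stableM T p1 i1) (congr1 pi h1)).
- exact: (etrans (stableM T p2 i2) (congr1 pi h2)).
- exact: (etrans (stableM T p1 i2) (etrans (congr1 pi h3) (stable0 _ _))).
- exact: (etrans (stableM T p2 i1) (etrans (congr1 pi h4) (stable0 _ _))).
Qed.

Lemma heart_abelian :
  enough_reflections T -> enough_coreflections T -> is_abelian (heart T).
Proof.
move=> hr hc; split; first exact: heart_additive.
- move=> [A hA] [B hB] f; have [f' ->] := stable_surj (f : @hom stable A B).
  have [K [k [hK hk]]] := heart_kernel_ex f' hc hA hB.
  by exists (exist _ K hK), (pi k); exact: heart_is_kernel.
- move=> [A hA] [B hB] f; have [f' ->] := stable_surj (f : @hom stable A B).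
  have [K [k [hK hk]]] := heart_cokernel_ex hr f' hA hB.
  by exists (exist _ K hK), (pi k); exact: heart_is_cokernel.
- move=> [A hA] [B hB] f; have [f' ->] := stable_surj (f : @hom stable A B).
  move=> fmono; have [|Q [c [hQ hk]]] :=
    @heart_mono_kernel C T hr hc A B f' hA hB.
    move=> X t hX /stable_eq0 ft; apply/stable_eq0.
    apply: (fmono (exist _ X hX)); rewrite compm0.
    by rewrite -ft heartM.
  by exists (exist _ Q hQ), (pi c); exact: heart_is_kernel.
- move=> [A hA] [B hB] f; have [f' ->] := stable_surj (f : @hom stable A B).
  move=> fepi; have [|K [k [hK hk]]] :=
    @heart_epi_cokernel C T A B f' hr hc hA hB.
    move=> X t hX /stable_eq0 ft; apply/stable_eq0.
    apply: (fepi (exist _ X hX)); rewrite comp0m.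
    by rewrite -ft heartM.
  by exists (exist _ K hK), (pi k); exact: heart_is_cokernel.
Qed.

End HeartAbelian.

(** * The heart functor *)

Section HeartFunctor.
Variables (C : extriangulated) (T : cotorsion_pair C).
Variable R : reflection_choice T.
Local Notation U := (cotU T).
Local Notation V := (cotV T).
Local Notation nul := (factors (cotW T)).
Local Notation S := (stable T).
Local Notation pi := (fmap (stable_functor T)).
Local Notation plus_obj B := (projT1 (plus R B)).
Local Notation minus_obj B := (projT1 (minus R B)).
Local Notation sm f := (sigma_minus_hom R f).
Local Notation sp f := (sigma_plus_hom R f).
Local Notation H := (heart_functor R).

Lemma sigma_minusD (A B : C) (f g : @hom S A B) : sm (f + g) = sm f + sm g.
Proof.
by apply/esym/sigma_minus_uniq; rewrite compDr !sigma_minusE compDl.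
Qed.

Lemma sigma_plusD (A B : C) (f g : @hom S A B) : sp (f + g) = sp f + sp g.
Proof.
by apply/esym/sigma_plus_uniq; rewrite compDl !sigma_plusE compDr.
Qed.

Lemma heart_functor_additive : additive_functor H.
Proof.
move=> A B f g.
exact: (etrans (congr1 (fun h => sm (sp h)) (stableD T f g))
  (etrans (congr1 (fun h => sm h) (sigma_plusD _ _)) (sigma_minusD _ _))).
Qed.

Lemma sigma_minus_rep (A B : C) (f : @hom C A B) :
  exists2 g : @hom C (minus_obj A) (minus_obj B), sm (pi f) = pi g &
    nul (projT2 (minus R B) \oc g - f \oc projT2 (minus R A)).
Proof.
have [g hg] := stable_surj (sm (pi f)); exists g => //.
by apply/stable_eq; rewrite -!stableM -hg; exact: sigma_minusE.
Qed.

Lemma sigma_plus_rep (A B : C) (f : @hom C A B) :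
  exists2 g : @hom C (plus_obj A) (plus_obj B), sp (pi f) = pi g &
    nul (g \oc projT2 (plus R A) - projT2 (plus R B) \oc f).
Proof.
have [g hg] := stable_surj (sp (pi f)); exists g => //.
by apply/stable_eq; rewrite -!stableM -hg; exact: sigma_plusE.
Qed.

Lemma sigma_minus_hom_inj (B M X Y : C) (m : @hom C B M) (r : @hom C M X)
    (g : @hom S (minus_obj M) Y) :
  conflation m r -> U X -> Bplus T Y -> g \oc sm (pi m) = 0 -> g = 0.
Proof.
move=> hm UX hY; have [mm -> hmm] := sigma_minus_rep m.
have [g' ->] := stable_surj g; rewrite stableM => /stable_eq0 hg.
apply/stable_eq0.
exact: (coreflection_hom_inj hm UX (minusP R B) (minusP R M) hmm hY hg).
Qed.

(** The lift to the coreflection of [B] of the class [push x d] is the push-out,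
along [sigma-(x)], of a lift of [d]; so it is killed by any [g] that kills
[sigma-(x)]. *)
Lemma sigma_minus_hom_extend (A B M X Y : C) (x : @hom C A B)
    (m : @hom C B M) (r : @hom C M X) (d : ext X A)
    (g : @hom S (minus_obj B) Y) :
  realizes m r (push x d) -> U X -> g \oc sm (pi x) = 0 ->
  exists h : @hom S (minus_obj M) Y, h \oc sm (pi m) = g.
Proof.
move=> hm UX; have [mm -> hmm] := sigma_minus_rep m.
have [xx -> hxx] := sigma_minus_rep x.
have [g' ->] := stable_surj g; rewrite stableM => /stable_eq0 hg.
have [_ _ cA] := minusP R A; have [d' hd] := cA _ UX d.
have e : push x d = push (projT2 (minus R B)) (push xx d').
  by rewrite -pushM (push_congr _ UX hxx) pushM hd.
rewrite e in hm.
have [|h hh] := coreflection_hom_extend (g := g') hm UX (minusP R B)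
  (minusP R M) hmm; first by rewrite -pushM (push_nul _ UX hg).
by exists (pi h); rewrite stableM; apply/stable_eq.
Qed.

Lemma sigma_minus_unit_inj (B Y : C)
    (g : @hom S (minus_obj (plus_obj B)) Y) :
  Bplus T Y -> g \oc sm (unit_plus R B) = 0 -> g = 0.
Proof.
have [_ [X [q [UX hq]]] _] := plusP R B.
exact: sigma_minus_hom_inj hq UX.
Qed.

(** With the class of the reflection pushed out along [u : E -> B], [E] in [U],
the map [g] kills [sigma-(u)]: as [E] is its own coreflection, the composite
factors through a map from [E] to an object of [B+]. *)
Lemma sigma_minus_unit_extend (B Y : C) (g : @hom S (minus_obj B) Y) :
  Bplus T Y ->
  exists h : @hom S (minus_obj (plus_obj B)) Y, h \oc sm (unit_plus R B) = g.
Proof.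
move=> hY; have [X [E [q [u [e [UX UE hq]]]]]] := reflection_class (plusP R B).
apply: (sigma_minus_hom_extend hq UX).
have [uu -> huu] := sigma_minus_rep u.
have hE : Bminus T E by apply: Bminus_of_nul => V1 f; exact: nul_UV.
have [s hs] := coreflection_ex (idm E) (minusP R E) hE.
have [hEm _ _] := minusP R E.
have hs' : nul (s \oc projT2 (minus R E) - idm _).
  apply: (coreflection_uniq (minusP R E) hEm).
  rewrite compBr compm1 compA -{3}[projT2 _]comp1m -compBl.
  exact: factors_compr.
have [g' ->] := stable_surj g; rewrite stableM; apply/stable_eq0.
rewrite -[g' \oc uu]compm1 -[idm _](subKr (s \oc projT2 (minus R E))) compBr.
apply: nulB; last exact: factors_compl.
by rewrite compA; apply: factors_compr; exact: Bplus_nul.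
Qed.

Lemma sigma_unit_natural (A B : C) (f : @hom S A B) :
  sm (sp f) \oc sm (unit_plus R A) = sm (unit_plus R B) \oc sm f.
Proof. by rewrite -!sigma_minusM sigma_plusE. Qed.

Lemma sigma_minus_eq0 (A B : C) (f : @hom S A B) :
  f \oc counit_minus R A = 0 -> sm f = 0.
Proof. by move=> h; apply/esym/sigma_minus_uniq; rewrite h compm0. Qed.

(** Maps from [B-] to [V] are null, so [sigma-] already kills [a]. *)
Lemma heart_functor_V (A Y : C) (a : @hom C A Y) : V Y -> sm (sp (pi a)) = 0.
Proof.
move=> VY; apply: sigma_minus_unit_inj.
  by have [] := sigma_composite_heart R Y.
rewrite sigma_unit_natural (sigma_minus_eq0 (f := pi a)) ?compm0 //.
rewrite stableM; apply/stable_eq0/Bminus_nul => //.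
by case: (minusP R A).
Qed.

(** By the two [sigma_minus_unit] lemmas, maps from [H(B)] into the heart are maps
from the coreflection of [B]; for the latter, [sigma_minus_hom_extend] and
[sigma_minus_hom_inj] are the cokernel property. *)
Lemma heart_functor_cokernel (A B M X V0 : C) (x : @hom C A B)
    (m : @hom C B M) (r : @hom C M X) (d : ext X A) (a : @hom C A V0)
    (w : @hom C V0 M) :
  realizes m r (push x d) -> U X -> V V0 -> m \oc x = w \oc a ->
  is_cokernel (fmap H x) (fmap H m).
Proof.
move=> hm UX VV0 e; split.
  rewrite -fmapM e fmapM.
  have -> : fmap H a = 0 by exact: heart_functor_V.
  by rewrite compm0.
move=> [Y [hY hY1]] t1 tx; pose t : @hom S (minus_obj (plus_obj B)) Y := t1.
have tx' : t \oc sm (sp (pi x)) = 0 by exact: tx.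
have cm : conflation m r by exists (push x d).
have [|h hh] := sigma_minus_hom_extend (g := t \oc sm (unit_plus R B)) hm UX.
  by rewrite -compA -sigma_unit_natural compA tx' comp0m.
have [s hs] := sigma_minus_unit_extend h hY.
have inj (s1 : @hom S (minus_obj (plus_obj M)) Y) :
    s1 \oc sm (sp (pi m)) = 0 -> s1 = 0.
  move=> h1; apply: (sigma_minus_unit_inj hY).
  apply: (sigma_minus_hom_inj cm UX hY).
  by rewrite -compA -sigma_unit_natural compA h1 comp0m.
have tsm : s \oc sm (sp (pi m)) = t.
  apply/eqP; rewrite -subr_eq0; apply/eqP/(sigma_minus_unit_inj hY).
  by rewrite compBl -compA sigma_unit_natural compA hs hh subrr.
exists s; split; first exact: tsm.
move=> s1 hs1; pose s2 : @hom S (minus_obj (plus_obj M)) Y := s1.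
have hs2 : s2 \oc sm (sp (pi m)) = t by exact: hs1.
suff e12 : s = s2 by exact: e12.
apply/eqP; rewrite -subr_eq0; apply/eqP/inj.
by rewrite compBl tsm hs2 subrr.
Qed.

(** Composition with the coreflection reduces the claim to [sigma+], where it is
[reflection_hom_inj]. *)
Lemma heart_functor_mono (M D V0 : C) (v : @hom C V0 M) (q : @hom C M D)
    (X : heart T) (t : hom X (H M)) :
  conflation v q -> V V0 -> fmap H q \oc t = 0 -> t = 0.
Proof.
move=> hq VV0; case: X t => [X [hX1 hX]] t0.
pose t : @hom S X (minus_obj (plus_obj M)) := t0 => ht0.
have ht : sm (sp (pi q)) \oc t = 0 by exact: ht0.
have {ht} : sp (pi q) \oc (counit_minus R (plus_obj M) \oc t) = 0.
  by rewrite compA -sigma_minusE -compA ht compm0.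
have [qq -> hqq] := sigma_plus_rep q; rewrite -[t0]/t.
have [t' ->] := stable_surj t.
have -> : counit_minus R (plus_obj M) \oc pi t' =
    pi (projT2 (minus R (plus_obj M)) \oc t') by exact: stableM.
rewrite stableM => /stable_eq0 h; apply/stable_eq0.
apply: (coreflection_uniq (minusP R (plus_obj M)) hX).
exact: (reflection_hom_inj hq VV0 (plusP R M) (plusP R D) hqq hX h).
Qed.

(** [M] and [M'] are the pushouts of the conflation [A -> V0 -> U0] along [x] and
of the given conflation along [a]. The cokernel [H(m)] of [H(x)] factors through
[H(m')], while [H(y)] is [H(m')] followed by a monomorphism: so the kernels of
[H(m)] and [H(y)] agree. *)
Lemma heart_functor_exact (A B D : C) (x : @hom C A B) (y : @hom C B D) :
  is_abelian (heart T) -> conflation x y -> exact (fmap H x) (fmap H y).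
Proof.
move=> hab [g hg].
have [V0 [U0 [a [u [VV0 UU0 [d hd]]]]]] := cot_right T A.
have [M [m [r hm]]] := realizes_ex (push x d).
have [|w [wa _]] := realizes_morph (a := x) (c := idm U0) hd hm.
  by rewrite pull1.
have [M' [v [q [m' [hM' _ qm po _]]]]] := weak_pushout_square a hg.
have [k km _] := po _ m w (esym wa).
have hc := heart_functor_cokernel hm UU0 VV0 (esym wa).
have [_ kernels _ _ _] := hab.
have [K [i hi]] := kernels _ _ (fmap H m).
have H0 (X Y : C) : fmap H (0 : hom X Y) = 0.
  by apply: (addrI (fmap H 0)); rewrite -heart_functor_additive !addr0.
exists (H M), (fmap H m), K, i; split=> //; split.
  have [|s [<- _]] := hc.2 _ (fmap H y).
    by rewrite -fmapM (conflation_comp0 hg) H0.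
  by rewrite -compA hi.1 compm0.
move=> X t yt; apply: hi.2.
rewrite -km fmapM -compA.
rewrite (@heart_functor_mono M' D V0 v q X (fmap H m' \oc t)) ?compm0 //.
  by exists (push a g).
by rewrite compA -fmapM qm.
Qed.

End HeartFunctor.

Theorem theorem3p5 (B : extriangulated) (T : cotorsion_pair B)
    (R : reflection_choice T) :
  cohomological (heart_functor R).
Proof.
have hab : is_abelian (heart T).
  apply: heart_abelian => X.
    by exists (projT1 (plus R X)), (projT2 (plus R X)); exact: plusP.
  by exists (projT1 (minus R X)), (projT2 (minus R X)); exact: minusP.
split=> //; first exact: heart_functor_additive.
by move=> X Y Z x y; exact: heart_functor_exact.
Qed.
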